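(* Let $\Delta\subset\mathfrak t^*$ be the Delzant simplex for $\mathbb{CP}^n$ centered at the origin, $\omega_\Delta$ and $\Phi_\Delta$ the associated Delzant symplectic form and momentum map on $\mathbb{CP}^n$, $\Pi_\Sigma$ the toric Poisson structure on $\mathbb{CP}^n$, and $\theta_\mu$ the modular vector field of $\Pi_\Sigma$ with respect to $\mu=\frac{1}{n!}\omega_\Delta^n$. If $F$ is a face of $\Delta$, then on the $T_{\mathbb C}$-orbit $\Phi_\Delta^{-1}(F^\circ)$ one has $\theta_\mu=0$ precisely on the set $\Phi_\Delta^{-1}(c_F)$, where $c_F$ is the centroid of $F$.
   Context: Let $T$ be a torus isomorphic to $\mathbb T^n$, $\mathbb T=\{|\zeta|=1\}$, $n\ge1$, with Lie algebra $\mathfrak t$, complexification $T_{\mathbb C}$ and integral lattice $\Lambda=\ker(\exp:\mathfrak t\to T)$. Let $u_1,\dots,u_n$ be a basis of $\Lambda$, $u_{n+1}=-\sum_{\ell=1}^n u_\ell$, and $\eta_1,\dots,\eta_n$ the dual basis of $\mathfrak t^*$. Let $\Delta=\{\nu\in\mathfrak t^*:\langle\nu,u_\ell\rangle+\frac1{n+1}\ge0,\ \ell=1,\dots,n+1\}$, which is the convex hull of $0,\eta_1,\dots,\eta_n$ translated by $-\frac{1}{n+1}(\eta_1+\dots+\eta_n)$. The torus $T_{\mathbb C}$ acts on $\mathbb{CP}^n=(\mathbb C^{n+1}\setminus\{0\})/\mathbb C^*$ so that, in the affine coordinates $w_k=z_k/z_{n+1}$, $k=1,\dots,n$, $u_k$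 generates the vector field $2\pi\,i w_k\partial_{w_k}+c.c.$ Toric Poisson structure: $\Pi=\sum_{\ell=1}^{n+1}i|z_\ell|^2\partial_{\bar z_\ell}\wedge\partial_{z_\ell}$ is a $(\mathbb C^* )^{n+1}$-invariant real Poisson structure on $\mathbb C^{n+1}$ (with $\partial_z=\frac12(\partial_x-i\partial_y)$, $\partial_{\bar z}=\frac12(\partial_x+i\partial_y)$), and $\Pi_\Sigma$ is the unique Poisson structure on $\mathbb{CP}^n$ making the quotient map $(\mathbb C^{n+1}\setminus\{0\},\Pi)\to\mathbb{CP}^n$ a Poisson map. Delzant structure: fix $h>0$ and $\hbar=h/2\pi$. Equip $\mathbb C^{n+1}$ with the nondegenerate Poisson structure $\pi=\sum_{\ell=1}^{n+1}i\,\partial_{\bar z_\ell}\wedge\partial_{z_\ell}$; let $N\cong\mathbb T$ be the diagonal circle and $Z=\{z:\frac1\hbar\sum_{\ell=1}^{n+1}|z_\ell|^2=1\}$, so $Z/N\cong\mathbb{CP}^n$ via $zN\mapsto[z]$. Then $\pi_\Delta$ is $h$ times the reduced Poisson structure on $Z/N=\mathbb{CP}^n$ (obtained from $\pi$ by symplectic reduction); it is nondegenerate, and $\omega_\Delta$ is the corresponding symplectic form. The momentum map $\Phi_\Delta:\mathbb{CP}^n\to\mathfrak t^*$ for the $T$-action, with image $\Delta$, is determined by $\langle\Phi_\Delta([z]),u_\ell\rangle+\frac1{n+1}=\frac1\hbar|z_\ell|^2$ for $z\in Z$, $\ell=1,\dots,n+1$. The $T_{\mathbb C}$-orbits in $\mathbb{CP}^n$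 are exactly the sets $\Phi_\Delta^{-1}(F^\circ)$, $F$ a (nonempty) face of $\Delta$ (including $\Delta$ itself and the vertices), where $F^\circ$ denotes the relative interior. The centroid of a simplex is the arithmetic mean of its vertices. Modular vector field: write $\pi^\#(\nu)=\pi(\nu,\cdot)$ for a Poisson structure $\pi$. For a positive density (volume form) $\mu$, the modular vector field $\theta_\mu$ of $\pi$ is defined by $\mathcal L_{\pi^\#(df)}\mu=\theta_\mu(f)\mu$ for all smooth $f$. *)

(* Defs.v *)
From HB Require Import structures.
From mathcomp Require Import all_boot all_order all_algebra all_fingroup.
From mathcomp Require Import finmap complex ring.
From mathcomp Require Import all_classical all_reals all_analysis.

Set Implicit Arguments.
Unset Strict Implicit.
Unset Printing Implicit Defensive.

Import Order.TTheory GRing.Theory Num.Theory.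
Import numFieldNormedType.Exports.

Local Open Scope classical_set_scope.
Local Open Scope complex_scope.
Local Open Scope ring_scope.

(** * Smooth functions *)

(* Only the germs of [f] at points of [U] matter; meant for open [U]. *)
Fixpoint Ck_on {R : realType} {V : normedModType R} (U : set V) (k : nat)
    (f : V -> R) : Prop :=
  match k with
  | 0%N => forall x, U x -> {for x, continuous f}
  | k'.+1 => (forall x, U x -> differentiable f x) /\
             (forall v : V, Ck_on U k' (fun x => 'D_v f x))
  end.

Definition smooth_on {R : realType} {V : normedModType R} (U : set V)
    (f : V -> R) : Prop :=
  forall k, Ck_on U k f.

(** * The space C^m, in real coordinates *)

(* The l-th row of [z : Cvec R m] is (Re z_l, Im z_l). *)
Notation Cvec R m := 'M[R]_(m, 2).

Definition zcoord {R : realType} {m} (z : Cvec R m) (l : 'I_m) : R[i] :=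
  z l 0 +i* z l 1.

Definition normsq {R : realType} {m} (z : Cvec R m) (l : 'I_m) : R :=
  z l 0 ^+ 2 + z l 1 ^+ 2.

Definition cscale {R : realType} {m} (c : R[i]) (z : Cvec R m) : Cvec R m :=
  \matrix_(l, b) (if b == 0 then complex.Re (c * zcoord z l)
                  else complex.Im (c * zcoord z l)).

Definition d_z {R : realType} {m} (l : 'I_m) (F : Cvec R m -> R)
    (z : Cvec R m) : R[i] :=
  2^-1 * (('D_(delta_mx l 0) F z)%:C - 'i * ('D_(delta_mx l 1) F z)%:C).

Definition d_zbar {R : realType} {m} (l : 'I_m) (F : Cvec R m -> R)
    (z : Cvec R m) : R[i] :=
  2^-1 * (('D_(delta_mx l 0) F z)%:C + 'i * ('D_(delta_mx l 1) F z)%:C).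

(* The value on (dF, dG) of the bivector
     \sum_l i a_l(z) \partial_{\bar z_l} /\ \partial_{z_l},
   where (X /\ Y)(dF, dG) = X(F) Y(G) - Y(F) X(G). *)
Definition cbivector {R : realType} {m} (a : Cvec R m -> 'I_m -> R)
    (F G : Cvec R m -> R) (z : Cvec R m) : R[i] :=
  \sum_(l < m) 'i * (a z l)%:C *
    (d_zbar l F z * d_z l G z - d_z l F z * d_zbar l G z).

Definition bivector {R : realType} {m} (a : Cvec R m -> 'I_m -> R)
    (F G : Cvec R m -> R) (z : Cvec R m) : R :=
  complex.Re (cbivector a F G z).

(* The bivector is real, so taking the real part loses nothing. *)
Lemma cbivectorE {R : realType} {m} (a : Cvec R m -> 'I_m -> R)
    (F G : Cvec R m -> R) (z : Cvec R m) :
  cbivector a F G z =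
  (\sum_(l < m) a z l / 2 *
     ('D_(delta_mx l 0) F z * 'D_(delta_mx l 1) G z -
      'D_(delta_mx l 1) F z * 'D_(delta_mx l 0) G z))%:C.
Proof.
rewrite rmorph_sum; apply: eq_bigr => l _ /=; rewrite /d_z /d_zbar.
set p := 'D_(delta_mx l 0) F z; set q := 'D_(delta_mx l 1) F z.
set r := 'D_(delta_mx l 0) G z; set s := 'D_(delta_mx l 1) G z.
set A := a z l.
have h2 : (2^-1 : R[i]) = (2^-1 : R)%:C by rewrite fmorphV rmorph_nat.
rewrite h2; apply/eqP; rewrite eq_complex /=.
by apply/andP; split; apply/eqP; field.
Qed.

(* \Pi = \sum_l i |z_l|^2 \partial_{\bar z_l} /\ \partial_{z_l} *)
Definition toric_bracket {R : realType} {m} : (Cvec R m -> R) ->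
    (Cvec R m -> R) -> Cvec R m -> R :=
  bivector normsq.

(* \pi = \sum_l i \partial_{\bar z_l} /\ \partial_{z_l} *)
Definition flat_bracket {R : realType} {m} : (Cvec R m -> R) ->
    (Cvec R m -> R) -> Cvec R m -> R :=
  bivector (fun _ _ => 1).

(** * CP^n *)

Definition Cline {R : realType} {m} (z : Cvec R m) : set (Cvec R m) :=
  [set cscale c z | c in [set c : R[i] | c != 0]].

Record CP (R : realType) (n : nat) := MkCP {
  CP_class :> set (Cvec R n.+1);
  _ : exists2 z, z != 0 & CP_class = Cline z }.

Definition nz_rep {R : realType} {n} (z : Cvec R n.+1) : Cvec R n.+1 :=
  if z == 0 then const_mx 1 else z.

Lemma nz_rep_neq0 {R : realType} {n} (z : Cvec R n.+1) : nz_rep z != 0.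
Proof.
rewrite /nz_rep; case: ifPn => // _; apply/eqP => /matrixP /(_ 0 0).
by rewrite !mxE; apply/eqP/oner_neq0.
Qed.

(* z |-> [z]; the value at z = 0 is junk. *)
Definition proj {R : realType} {n} (z : Cvec R n.+1) : CP R n :=
  MkCP (ex_intro2 _ _ (nz_rep z) (nz_rep_neq0 z) erefl).

(* Inverse of the affine chart z |-> (z_k / z_j)_{k <> j} on {z_j <> 0};
   it is defined on all of C^n. *)
Definition affine {R : realType} {n} (j : 'I_n.+1) (w : Cvec R n) : CP R n :=
  proj (\matrix_(l, b) (if unlift j l is Some k then w k b else (b == 0)%:R)).

Record smoothfn (R : realType) (n : nat) := SmoothFn {
  smoothfn_fun :> CP R n -> R;
  _ : forall j, smooth_on setT (smoothfn_fun \o affine j) }.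

(** * Vector fields, tangent vectors and Poisson structures on CP^n *)

(* Vector fields are derivations of the algebra of smooth functions. *)
Definition is_vector_field {R : realType} {n}
    (X : smoothfn R n -> smoothfn R n) : Prop :=
  (forall (a : R) (f g k : smoothfn R n), (forall p, k p = a * f p + g p) ->
     forall p, X k p = a * X f p + X g p) /\
  (forall f g k : smoothfn R n, (forall p, k p = f p * g p) ->
     forall p, X k p = f p * X g p + g p * X f p).

Definition vanishes_at {R : realType} {n}
    (X : smoothfn R n -> smoothfn R n) (p : CP R n) : Prop :=
  forall f, X f p = 0.

Notation tvec R n := (smoothfn R n -> R).

Definition is_tangent {R : realType} {n} (p : CP R n) (v : tvec R n) : Prop :=
  (forall (a : R) (f g k : smoothfn R n), (forall x, k x = a * f x + g x) ->
     v k = a * v f + v g) /\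
  (forall f g k : smoothfn R n, (forall x, k x = f x * g x) ->
     v k = f p * v g + g p * v f).

Definition value_at {R : realType} {n}
    (X : smoothfn R n -> smoothfn R n) (p : CP R n) : tvec R n :=
  fun f => X f p.

(* A Poisson structure B is given by its bracket B f g = B(df, dg), so the
   Hamiltonian vector field B^#(df) = B(df, .) is the derivation [B f]. *)
Definition is_poisson {R : realType} {n}
    (B : smoothfn R n -> smoothfn R n -> smoothfn R n) : Prop :=
  [/\ forall f, is_vector_field (B f),
      forall f g p, B f g p = - B g f p &
      forall f g k p, B f (B g k) p + B g (B k f) p + B k (B f g) p = 0].

(* z |-> [z] is a Poisson map from (C^(n+1) \ 0, \Pi) to (CP^n, B). *)
Definition is_toric_poisson {R : realType} {n}
    (B : smoothfn R n -> smoothfn R n -> smoothfn R n) : Prop :=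
  is_poisson B /\
  forall (f g : smoothfn R n) (z : Cvec R n.+1), z != 0 ->
    toric_bracket (f \o proj) (g \o proj) z = B f g (proj z).

(** * The Delzant structure *)

Definition planck {R : realType} (h : R) : R := h / (2 * pi).

Definition Zlevel {R : realType} {n} (h : R) : set (Cvec R n.+1) :=
  [set z | (planck h)^-1 * \sum_l normsq z l = 1].

(* [F] is an extension, invariant under the diagonal circle N, of the pullback
   of [f] to Z, defined on the N-invariant open neighbourhood C^(n+1) \ 0
   of Z. *)
Definition invariant_extension {R : realType} {n} (h : R) (f : smoothfn R n)
    (F : Cvec R n.+1 -> R) : Prop :=
  [/\ smooth_on [set z | z != 0] F,
      forall (c : R[i]) z, `|c| = 1 -> F (cscale c z) = F z &
      forall z, Zlevel h z -> F z = f (proj z)].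

(* Reduction of \pi to Z/N = CP^n. *)
Definition is_reduced_poisson {R : realType} {n} (h : R)
    (B : smoothfn R n -> smoothfn R n -> smoothfn R n) : Prop :=
  is_poisson B /\
  forall (f g : smoothfn R n) F G,
    invariant_extension h f F -> invariant_extension h g G ->
    forall z, Zlevel h z -> B f g (proj z) = flat_bracket F G z.

Definition is_delzant_poisson {R : realType} {n} (h : R)
    (B : smoothfn R n -> smoothfn R n -> smoothfn R n) : Prop :=
  is_poisson B /\
  exists2 B0, is_reduced_poisson h B0 & forall f g p, B f g p = h * B0 f g p.

(** * Differential forms on CP^n *)

(* The tangent vector at [affine j w] with components [v] in the chart j. *)
Definition chart_vec {R : realType} {n} (j : 'I_n.+1) (w v : Cvec R n) :
    tvec R n :=
  fun f => 'D_v (f \o affine j) w.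

(* The components of a tangent vector at [affine j w] in the chart j. *)
Definition components {R : realType} {n} (j : 'I_n.+1) (w : Cvec R n)
    (d : tvec R n) : Cvec R n :=
  xget 0 [set v | d = chart_vec j w v].

Definition coord_vec {R : realType} {n} (j : 'I_n.+1) (w : Cvec R n)
    (a : 'I_n * 'I_2) : tvec R n :=
  chart_vec j w (delta_mx a.1 a.2).

(* [om p] only matters on tangent vectors at p. *)
Notation twoform R n := (CP R n -> tvec R n -> tvec R n -> R).

Definition twoform_coef {R : realType} {n} (om : twoform R n) (j : 'I_n.+1)
    (a b : 'I_n * 'I_2) (w : Cvec R n) : R :=
  om (affine j w) (coord_vec j w a) (coord_vec j w b).

Definition is_twoform {R : realType} {n} (om : twoform R n) : Prop :=
  [/\ forall p (c : R) (v v' v'' : tvec R n),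
        is_tangent p v -> is_tangent p v' -> is_tangent p v'' ->
        om p (fun f => c * v f + v' f) v'' = c * om p v v'' + om p v' v'',
      forall p (v v' : tvec R n), is_tangent p v -> is_tangent p v' ->
        om p v v' = - om p v' v &
      forall j a b, smooth_on setT (twoform_coef om j a b)].

Definition is_symplectic {R : realType} {n} (om : twoform R n) : Prop :=
  [/\ is_twoform om,
      forall p v, is_tangent p v ->
        (forall v', is_tangent p v' -> om p v v' = 0) -> v = (fun=> 0) &
      forall j (a b c : 'I_n * 'I_2) (w : Cvec R n),
        'D_(delta_mx a.1 a.2) (twoform_coef om j b c) w +
        'D_(delta_mx b.1 b.2) (twoform_coef om j c a) w +
        'D_(delta_mx c.1 c.2) (twoform_coef om j a b) w = 0].

(* om is the inverse of B, with the sign convention om(X_f, X_g) = B(df, dg)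
   for X_f = B^#(df). *)
Definition is_symplectic_form_of {R : realType} {n}
    (B : smoothfn R n -> smoothfn R n -> smoothfn R n) (om : twoform R n) :
    Prop :=
  is_symplectic om /\
  forall f g p, om p (value_at (B f) p) (value_at (B g) p) = B f g p.

(* Forms of degree 2n, evaluated on families indexed by 'I_n * 'I_2 taken in
   lexicographic order; on coordinate vectors this is the order
   x_1, y_1, ..., x_n, y_n. *)
Notation topform R n := (CP R n -> ('I_n * 'I_2 -> tvec R n) -> R).

(* om^n = om /\ ... /\ om, with the convention
   (al /\ be)(v) = 1/(k! l!) \sum_s sgn(s) al(v_{s 1}, ..., v_{s k})
                                          be(v_{s (k+1)}, ..., v_{s (k+l)}). *)
Definition wedge_power {R : realType} {n} (om : twoform R n) : topform R n :=
  fun p v => (2 ^+ n)^-1 *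
    \sum_(s : {perm 'I_n * 'I_2}) (-1) ^+ s *
      \prod_(k < n) om p (v (s (k, 0))) (v (s (k, 1))).

Definition liouville {R : realType} {n} (om : twoform R n) : topform R n :=
  fun p v => (n`!%:R)^-1 * wedge_power om p v.

(** * Modular vector fields *)

(* mu = (density mu j) dx_1 dy_1 ... dx_n dy_n in the chart j. *)
Definition density {R : realType} {n} (mu : topform R n) (j : 'I_n.+1)
    (w : Cvec R n) : R :=
  mu (affine j w) (coord_vec j w).

(* The coefficient in the chart j of the Lie derivative L_X mu, from
   L_X (rho dx) = (\sum_a \partial_a (rho X^a)) dx. *)
Definition lie_density {R : realType} {n}
    (X : smoothfn R n -> smoothfn R n) (mu : topform R n) (j : 'I_n.+1)
    (w : Cvec R n) : R :=
  \sum_(k < n) \sum_(b < 2)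
    'D_(delta_mx k b) (fun w' : Cvec R n => density mu j w' *
       components j w' (value_at X (affine j w')) k b) w.

(* L_{B^#(df)} mu = theta(f) mu for all f. *)
Definition is_modular {R : realType} {n}
    (B : smoothfn R n -> smoothfn R n -> smoothfn R n) (mu : topform R n)
    (theta : smoothfn R n -> smoothfn R n) : Prop :=
  is_vector_field theta /\
  forall f j w,
    lie_density (B f) mu j w = theta f (affine j w) * density mu j w.

(** * Polytopes in R^n *)

Definition pairing {R : realType} {n} (nu : 'rV[R]_n) (x : 'cV[R]_n) : R :=
  (nu *m x) 0 0.

(* Nonempty faces: intersections with supporting hyperplanes, including the
   polytope itself (xi = 0). *)
Definition is_face {R : realType} {n} (P F : set 'rV[R]_n) : Prop :=
  F !=set0 /\
  exists (xi : 'cV[R]_n) (c : R),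
    (forall nu, P nu -> c <= pairing nu xi) /\
    F = P `&` [set nu | pairing nu xi = c].

Definition vertices {R : realType} {n} (P : set 'rV[R]_n) : set 'rV[R]_n :=
  [set v | is_face P [set v]].

Definition centroid {R : realType} {n} (P : set 'rV[R]_n) : 'rV[R]_n :=
  (#|` fset_set (vertices P)|%:R)^-1 *: \sum_(v \in vertices P) v.

Definition affine_hull {R : realType} {n} (A : set 'rV[R]_n) : set 'rV[R]_n :=
  [set y | exists (m : nat) (x : 'I_m -> 'rV[R]_n) (c : 'I_m -> R),
     [/\ forall i, A (x i), \sum_i c i = 1 & y = \sum_i c i *: x i]].

Definition relint {R : realType} {n} (A : set 'rV[R]_n) : set 'rV[R]_n :=
  [set x | A x /\ exists2 e : R, 0 < e &
     forall y, affine_hull A y -> `|y - x| < e -> A y].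

(** * The Delzant simplex *)

(* The Lie algebra of T is R^n (column vectors), its dual is the space of row
   vectors, and the lattice \Lambda is the Z-span of the basis u. *)
Definition is_basis {R : realType} {n} (u : 'I_n -> 'cV[R]_n) : Prop :=
  (\matrix_(i, k) u k i 0) \in unitmx.

(* u_1, ..., u_n, u_(n+1) = - (u_1 + ... + u_n). *)
Definition normals {R : realType} {n} (u : 'I_n -> 'cV[R]_n) (l : 'I_n.+1) :
    'cV[R]_n :=
  if unlift ord_max l is Some k then u k else - \sum_k u k.

Definition simplex {R : realType} {n} (u : 'I_n -> 'cV[R]_n) : set 'rV[R]_n :=
  [set nu | forall l : 'I_n.+1, 0 <= pairing nu (normals u l) + n.+1%:R^-1].

Definition is_delzant_momentum {R : realType} {n} (h : R)
    (u : 'I_n -> 'cV[R]_n) (Phi : CP R n -> 'rV[R]_n) : Prop :=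
  forall (z : Cvec R n.+1) (l : 'I_n.+1), Zlevel h z ->
    pairing (Phi (proj z)) (normals u l) + n.+1%:R^-1 =
    (planck h)^-1 * normsq z l.

(* Main.v *)
Require Import Defs.
From HB Require Import structures.
From mathcomp Require Import all_boot all_order all_algebra all_fingroup.
From mathcomp Require Import finmap complex ring.
From mathcomp Require Import all_classical all_reals all_analysis.
(* [charge.cscale] would otherwise hide the [cscale] of Defs. *)
Import Defs.

Set Implicit Arguments.
Unset Strict Implicit.
Unset Printing Implicit Defensive.

Import Order.TTheory GRing.Theory Num.Theory.
Import numFieldNormedType.Exports.

Local Open Scope classical_set_scope.
Local Open Scope complex_scope.
Local Open Scope ring_scope.

(** In the affine chart [z_j = 1] put [q = 1 + |w|^2], and let [<w, v>] be the
  Hermitian product and [c] the gradient of [f]. Homogeneity of [f([z])] gives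
  its derivatives along [z_j], hence the Hamiltonian vector fields of [f]:
  [(i/2) (|w_k|^2 c_k + <w, c> w_k)_k] for the toric structure and
  [pi q i (c + <w, c> w)] for the Delzant structure. Inverting the latter gives
  the Fubini-Study form. Its derivative along [v] is its pullback by the
  infinitesimal automorphism [x |-> - (Re <w, v> x + <w, x> v) / q], of real
  trace [- (n+1) d_v q / q], so the Liouville density is a nonzero constant
  times [q^-(n+1)]. The divergence formula then yields
    [theta f = ((n+1) / q) \sum_k (|w_k|^2 - 1) d_(phi_k) f],
  where [phi_k] is the argument of [w_k]. Hence [theta] vanishes at [[z]] iff
  all the nonzero [|z_l|] are equal. As [|z_l|^2 / |z|^2] are the barycentric
  coordinates of the momentum, this says that the momentum is the centroid of
  the face containing it in its relative interior. *)

(** * Calculus *)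

Section Locality.
Context {R : realType} {V W : normedModType R}.

(** Tangent vectors are derivations of globally smooth functions, so chart components make sense
    only once enough global functions are at hand: the quotients [(c . w + d) / q] extend to all of
    projective space and realise every covector at a point. They make components unique, let the
    bivector be inverted pointwise, and finally test the phases one at a time. The automorphism
    behind the derivative of the form is the Christoffel term [- (<w, v> x + <w, x> v) / q] of the
    Fubini-Study connection, with [<w, v>] replaced by its real part; the difference is a real
    multiple of [i x], which leaves the form infinitesimally invariant. As only its trace enters,
    the Pfaffian is never expanded at a general point: its logarithmic derivative gives the density
    up to a constant, and a sign argument at the origin shows this constant to be nonzero. The
    constants n!, 2^n and the power of pi then cancel, while h has already dropped out because
    [h / hbar = 2 pi]. The divergence of a Hamiltonian field contains second derivatives of [f],
    which cancel only by the symmetry of mixed derivatives. *)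

Lemma near_eq_differentiable (f g : V -> W) (x : V) :
  (\forall y \near x, f y = g y) -> differentiable f x -> differentiable g x.
Proof.
move=> fg df.
have fgx : f x = g x by exact: nbhs_singleton fg.
have [dfc] := (diff_locallyP x f).1 df.
move=> fE.
have gE : g \o shift x = cst (g x) + 'd f x +o_ 0 id.
  apply/eqaddoP => _/posnumP[e].
  have /eqaddoP/(_ e%:num) := fE.
  move=> /(_ (gt0 e)) H.
  have fg0 : \forall y \near (0 : V), f (y + x) = g (y + x).
    by move: fg; rewrite [X in X -> _](near_shift 0) subr0.
  near=> y.
  have : f (y + x) = g (y + x) by near: y.
  have : `|(f \o shift x - (cst (f x) + 'd f x)) y| <= e%:num * `|y|.
    by near: y; exact: H.
  by rewrite !fctE /= => + <-; rewrite fgx.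
apply/diff_locallyP.
by rewrite (diff_unique dfc gE).
Unshelve. all: by end_near. Qed.

End Locality.

(** * Closure of the classes C^k under algebraic operations and composition *)

Section CkCalculus.
Context {R : realType}.

Lemma Ck_onS {V : normedModType R} (U : set V) k (f : V -> R) :
  Ck_on U k.+1 f -> Ck_on U k f.
Proof.
elim: k f => [|k IH] f [fd fD].
  by move=> x Ux; apply: differentiable_continuous; exact: fd.
by split=> // v; exact: IH (fD v).
Qed.

Lemma smooth_on_diff {V : normedModType R} (U : set V) (f : V -> R) x :
  smooth_on U f -> U x -> differentiable f x.
Proof. by move=> /(_ 1%N)[fd _] /fd. Qed.

Lemma smooth_on_derive {V : normedModType R} (U : set V) (f : V -> R) v :
  smooth_on U f -> smooth_on U ('D_v f).
Proof. by move=> sf k; have [_] := sf k.+1; apply. Qed.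

Lemma eq_Ck_on {V : normedModType R} (U : set V) k (f g : V -> R) : open U ->
  (forall x, U x -> f x = g x) -> Ck_on U k f -> Ck_on U k g.
Proof.
move=> oU; elim: k f g => [|k IH] f g fg.
  move=> fc x Ux; have := fc x Ux; rewrite /prop_for /continuous_at -(fg x Ux).
  apply: cvg_trans; apply: near_eq_cvg.
  by apply: filterS (open_nbhs_nbhs (conj oU Ux)) => y /fg.
move=> [fd fD]; split=> [x Ux|v].
  apply: near_eq_differentiable (fd x Ux).
  by apply: filterS (open_nbhs_nbhs (conj oU Ux)) => y /fg.
apply: IH (fD v) => x Ux; apply: near_eq_derive.
by apply: filterS (open_nbhs_nbhs (conj oU Ux)) => y /fg.
Qed.

Lemma sub_Ck_on {V : normedModType R} (U U' : set V) k (f : V -> R) :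
  U' `<=` U -> Ck_on U k f -> Ck_on U' k f.
Proof.
move=> sU; elim: k f => [|k IH] f /=; first by move=> fc x /sU; exact: fc.
by move=> [fd fD]; split=> [x /sU/fd//|v]; exact: IH.
Qed.

Lemma Ck_on_bigcup {V : normedModType R} I (U : I -> set V) k (f : V -> R) :
  (forall i, Ck_on (U i) k f) -> Ck_on (\bigcup_i U i) k f.
Proof.
elim: k f => [|k IH] f fU; first by move=> x [i _ Uix]; exact: (fU i).
split=> [x [i _ Uix]|v]; first by have [+ _] := fU i; exact.
by apply: IH => i; have [_] := fU i; exact.
Qed.

Lemma Ck_on_cst {V : normedModType R} (U : set V) k (c : R) :
  Ck_on U k (fun=> c).
Proof.
elim: k c => [|k IH] c /=; first by move=> x _; exact: cst_continuous.
split=> [x _|v]; first exact: differentiable_cst.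
have -> : 'D_v (fun=> c) = fun=> 0 by apply/funext => x; exact: derive_cst.
exact: IH.
Qed.

Lemma Ck_onD {V : normedModType R} (U : set V) k (f g : V -> R) : open U ->
  Ck_on U k f -> Ck_on U k g -> Ck_on U k (fun x => f x + g x).
Proof.
move=> oU; elim: k f g => [|k IH] f g.
  by move=> fc gc x Ux; apply: continuousD; [exact: fc|exact: gc].
move=> [fd fD] [gd gD]; split=> [x Ux|v].
  by apply: differentiableD; [exact: fd|exact: gd].
apply: eq_Ck_on (IH _ _ (fD v) (gD v)) => // x Ux.
by rewrite -deriveD //; apply: diff_derivable; [exact: fd|exact: gd].
Qed.

Lemma Ck_onM {V : normedModType R} (U : set V) k (f g : V -> R) : open U ->
  Ck_on U k f -> Ck_on U k g -> Ck_on U k (fun x => f x * g x).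
Proof.
move=> oU; elim: k f g => [|k IH] f g.
  by move=> fc gc x Ux; apply: continuousM; [exact: fc|exact: gc].
move=> fk gk; have [fd fD] := fk; have [gd gD] := gk; split=> [x Ux|v].
  by apply: differentiableM; [exact: fd|exact: gd].
have := Ck_onD oU (IH _ _ (Ck_onS fk) (gD v)) (IH _ _ (Ck_onS gk) (fD v)).
apply: eq_Ck_on => // x Ux.
rewrite -[RHS]/('D_v (f * g) x) deriveM //; apply: diff_derivable.
  exact: fd.
exact: gd.
Qed.

Lemma Ck_onN {V : normedModType R} (U : set V) k (f : V -> R) : open U ->
  Ck_on U k f -> Ck_on U k (fun x => - f x).
Proof.
move=> oU fk; apply: eq_Ck_on (Ck_onM oU (Ck_on_cst U k (-1)) fk) => // x _.
by rewrite mulN1r.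
Qed.

Lemma Ck_onV {V : normedModType R} (U : set V) k (f : V -> R) : open U ->
  (forall x, U x -> f x != 0) -> Ck_on U k f -> Ck_on U k (fun x => (f x)^-1).
Proof.
move=> oU f0; elim: k => [|k IH].
  by move=> fc x Ux; apply: continuousV; [exact: f0|exact: fc].
move=> fk; have [fd fD] := fk; split=> [x Ux|v].
  by apply: differentiableV; [exact: fd|exact: f0].
have fV := IH (Ck_onS fk).
(* The derivative of [1 / f] is [- (1 / f)^2 D_v f], and the induction hypothesis covers the factors
   [1 / f]. *)
have := Ck_onM oU (Ck_on_cst U k (-1)) (Ck_onM oU (Ck_onM oU fV fV) (fD v)).
apply: eq_Ck_on => // x Ux; rewrite [RHS](@deriveV _ _ f); last 2 first.
- exact: f0.
- by apply: diff_derivable; exact: fd.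
by rewrite mulN1r expr2 invfM scaleNr.
Qed.

Lemma Ck_on_sum {V : normedModType R} (U : set V) k m (f : 'I_m -> V -> R) :
  open U -> (forall i, Ck_on U k (f i)) ->
  Ck_on U k (fun x => \sum_i f i x).
Proof.
move=> oU; elim: m f => [|m IH] f fk.
  by under eq_fun do rewrite big_ord0; exact: Ck_on_cst.
under eq_fun do rewrite big_ord_recl.
by apply: Ck_onD => //; apply: IH.
Qed.

Lemma is_derive_big {V : normedModType R} (I : Type) (r : seq I) (P : pred I) (f : I -> V -> R) (x v : V)
    (df : I -> R) : (forall i, is_derive x v (f i) (df i)) ->
  is_derive x v (fun y => \sum_(i <- r | P i) f i y) (\sum_(i <- r | P i) df i).
Proof.
move=> fd; elim: r => [|i r IH].
  rewrite big_nil; under eq_fun do rewrite big_nil; exact: is_derive_cst.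
rewrite big_cons; under eq_fun do rewrite big_cons.
by case: (P i) => //; exact: is_deriveD.
Qed.

Lemma is_derive_coord m n (i : 'I_m) (j : 'I_n) (x v : 'M[R]_(m, n)) :
  is_derive x v (fun N : 'M[R]_(m, n) => N i j : R) (v i j).
Proof.
have d : derivable (fun N : 'M[R]_(m, n) => N i j : R) x v.
  by apply: diff_derivable; exact: differentiable_coord.
apply: DeriveDef => //.
have := derive_mx (@derivable_id R 'M[R]_(m, n) x v).
by rewrite derive_id => /matrixP /(_ i j); rewrite mxE.
Qed.

Lemma Ck_on_coord m n (U : set 'M[R]_(m, n)) k i j :
  Ck_on U k (fun N : 'M[R]_(m, n) => N i j : R).
Proof.
case: k => [|k] /=; first by move=> x _; exact: coord_continuous.
split=> [x _|v]; first exact: differentiable_coord.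
have -> : 'D_v (fun N : 'M[R]_(m, n) => N i j : R) = fun=> v i j.
  by apply/funext => x; have [] := is_derive_coord i j x v.
exact: Ck_on_cst.
Qed.

Lemma derive_delta m n (f : 'M[R]_(m, n) -> R) x v : differentiable f x ->
  'D_v f x = \sum_i \sum_j v i j * 'D_(delta_mx i j) f x.
Proof.
move=> fd; rewrite deriveE // [in LHS](matrix_sum_delta v) linear_sum.
apply: eq_bigr => i _; rewrite linear_sum; apply: eq_bigr => j _.
by rewrite linearZ deriveE.
Qed.

Lemma differentiable_mx {V : normedModType R} m n (p : V -> 'M[R]_(m, n)) x :
  (forall i j, differentiable (fun y => p y i j) x) -> differentiable p x.
Proof.
move=> pd.
rewrite (_ : p = \sum_(i < m) \sum_(j < n) (fun y => p y i j *: delta_mx i j)).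
  apply: differentiable_sum => i; apply: differentiable_sum => j.
  exact: differentiableZl.
apply/funext => y; rewrite [LHS]matrix_sum_delta !fct_sumE.
by apply: eq_bigr => i _; rewrite fct_sumE.
Qed.

(** The chain rule is written entrywise because its right-hand side is then a sum of products to
    which an induction on the order of differentiability applies. *)
Lemma derive_comp_mx {V : normedModType R} m n (p : V -> 'M[R]_(m, n))
    (f : 'M[R]_(m, n) -> R) x v :
  (forall i j, differentiable (fun y => p y i j) x) ->
  differentiable f (p x) ->
  'D_v (f \o p) x =
  \sum_i \sum_j 'D_v (fun y => p y i j) x * 'D_(delta_mx i j) f (p x).
Proof.
move=> pd fd; have pdx := differentiable_mx pd.
rewrite deriveE; last exact: differentiable_comp.
rewrite diff_comp //= -deriveE // derive_delta //.
apply: eq_bigr => i _; apply: eq_bigr => j _.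
rewrite -deriveE // derive_mx ?mxE //.
exact: diff_derivable.
Qed.

Lemma Ck_on_comp {V : normedModType R} (U : set V) k m n
    (p : V -> 'M[R]_(m, n)) (f : 'M[R]_(m, n) -> R) : open U ->
  (forall i j, Ck_on U k (fun x => p x i j)) -> Ck_on setT k f ->
  Ck_on U k (f \o p).
Proof.
move=> oU; elim: k f => [|k IH] f pk.
  move=> fc x Ux; apply: continuous_comp; last exact: fc.
  move=> A [P Pn sPA]; rewrite !nbhs_simpl /=.
  have : \forall y \near x, forall i j, P i j (p y i j).
    apply: filter_forall => i; apply: filter_forall => j.
    exact: (pk i j x Ux) (Pn i j).
  by apply: filterS => y Py; exact: sPA.
move=> [fd fD]; have pd x : U x -> forall i j, differentiable (fun y => p y i j) x.
  by move=> Ux i j; have [+ _] := pk i j; exact.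
split=> [x Ux|v].
  by apply: differentiable_comp; [exact: differentiable_mx (pd _ Ux)|exact: fd].
have H : Ck_on U k (fun x => \sum_i \sum_j 'D_v (fun y => p y i j) x *
    ('D_(delta_mx i j) f \o p) x).
  apply: Ck_on_sum => // i; apply: Ck_on_sum => // j; apply: Ck_onM => //.
    by have [_] := pk i j; exact.
  by apply: IH (fD _) => i' j'; exact: Ck_onS (pk i' j').
apply: eq_Ck_on H => // x Ux; rewrite derive_comp_mx //; first exact: pd.
exact: fd.
Qed.

End CkCalculus.

(** * Symmetry of mixed second derivatives *)

Section Schwarz.
Context {R : realType} {V : normedModType R}.

Lemma is_derive_line (f : V -> R) (x u : V) (r : R) :
  derivable f (x + r *: u) u ->
  is_derive r 1 (fun s : R => f (x + s *: u)) ('D_u f (x + r *: u)).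
Proof.
move=> df; have E : (fun h : R => h^-1 *: (((fun s : R => f (x + s *: u)) \o
    shift r) (h *: 1) - f (x + r *: u))) = (fun h => h^-1 *:
    ((f \o shift (x + r *: u)) (h *: u) - f (x + r *: u))).
  apply/funext => h /=; congr (_ *: (f _ - _)).
  by rewrite [h *: 1]mulr1 scalerDl addrCA.
by apply: DeriveDef; rewrite /derivable/derive E.
Qed.

Lemma MVT_line (f : V -> R) (x u : V) (s : R) : 0 < s ->
  (forall y, differentiable f y) ->
  exists2 c, 0 < c < s & f (x + s *: u) - f x = s * 'D_u f (x + c *: u).
Proof.
move=> s0 fd; have dl r := is_derive_line (diff_derivable (v := u) (fd (x + r *: u))).
have [|c] := @MVT R (fun r => f (x + r *: u)) (fun r => 'D_u f (x + r *: u)) 0 s s0 (fun r _ => dl r).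
  apply: derivable_within_continuous => r _; exact: ex_derive.
rewrite in_itv /= => cs; rewrite scale0r addr0 subr0 mulrC => E.
by exists c.
Qed.

(** The mean value theorem is used along [u] for [f (y + s v) - f y], then along [v] for
    ['D_u f]. *)
Lemma MVT_second_difference (f : V -> R) (x u v : V) (s : R) : 0 < s ->
  (forall y, differentiable f y) -> (forall y, differentiable ('D_u f) y) ->
  exists c d, [/\ 0 < c < s, 0 < d < s &
  f (x + s *: u + s *: v) - f (x + s *: u) - f (x + s *: v) + f x =
  s ^+ 2 * 'D_v ('D_u f) (x + c *: u + d *: v)].
Proof.
move=> s0 fd fud.
pose g y := f (y + s *: v) - f y.
have shd y : differentiable (fun y => f (y + s *: v)) y.
  apply: differentiable_comp; last exact: fd.
  exact: differentiableD.
have gd y : differentiable g y by exact: differentiableB.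
have [c cs gE] := MVT_line x u s0 gd.
have Dg : 'D_u g (x + c *: u) = 'D_u f (x + c *: u + s *: v) - 'D_u f (x + c *: u).
  rewrite [LHS](@deriveB _ _ _ (fun y => f (y + s *: v)) f); first last.
  - exact: diff_derivable (fd _).
  - exact: diff_derivable (shd _).
  congr (_ - _); rewrite /derive.
  by under eq_fun do rewrite /= -addrA.
have [d ds hE] := MVT_line (x + c *: u) v s0 fud.
exists c, d; split=> //; rewrite expr2 -mulrA -hE -Dg -gE /g.
by ring.
Qed.

(** The second difference is symmetric in [u] and [v], so the two mixed derivatives agree at points
    arbitrarily close to [x], though not at the same one; continuity of both carries the equality to
    [x]. *)
Lemma derive_sym (f : V -> R) (x u v : V) : Ck_on setT 2 f ->
  'D_v ('D_u f) x = 'D_u ('D_v f) x.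
Proof.
move=> [fd fD]; have fd' y : differentiable f y by exact: fd.
have fud w y : differentiable ('D_w f) y by have [+ _] := fD w; exact.
have cts w w' : {for x, continuous ('D_w' ('D_w f))}.
  by have [_ /(_ w')] := fD w; exact.
apply/eqP; rewrite -subr_eq0 -normr_le0; apply/ler_addgt0Pr => e e0.
rewrite add0r.
have Sx : (fun p : R * R => x + p.1 *: u + p.2 *: v) @ (0 : R, 0 : R) --> x.
  rewrite -[X in _ --> X]addr0 -[X in X + _]addr0 -[X in _ + X + _](scale0r u).
  rewrite -[X in _ --> _ + X](scale0r v).
  apply: cvgD; first apply: cvgD; first exact: cvg_cst.
    by apply: cvgZr_tmp; exact: cvg_fst.
  by apply: cvgZr_tmp; exact: cvg_snd.
have near w w' : \forall p \near (0 : R, 0 : R),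
    `|'D_w' ('D_w f) x - 'D_w' ('D_w f) (x + p.1 *: u + p.2 *: v)| < e / 2.
  have /cvgrPdist_lt H := cvg_comp _ _ Sx (cts w w').
  by apply: H; exact: divr_gt0.
have /nbhs_ballP[d1 /= d10 H1] := near u v.
have /nbhs_ballP[d2 /= d20 H2] := near v u.
pose s := Num.min d1 d2 / 2.
have sm : 0 < Num.min d1 d2 by rewrite lt_min d10.
have s0 : 0 < s by exact: divr_gt0.
have sd1 : s < d1.
  have mle : Num.min d1 d2 <= d1 by rewrite ge_min lexx ?orbT.
  rewrite /s ltr_pdivrMr // (le_lt_trans mle) //.
  by rewrite ltr_pMr // ltr1n.
have sd2 : s < d2.
  have mle : Num.min d1 d2 <= d2 by rewrite ge_min lexx ?orbT.
  rewrite /s ltr_pdivrMr // (le_lt_trans mle) //.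
  by rewrite ltr_pMr // ltr1n.
have [c [d [cs ds E1]]] := MVT_second_difference x v s0 fd' (fud u).
have [c' [d' [cs' ds' E2]]] := MVT_second_difference x u s0 fd' (fud v).
have bl a b r : 0 < a < s -> 0 < b < s -> s < r -> ball (0 : R, 0 : R) r (a, b).
  move=> /andP[a0 as_] /andP[b0 bs] sr; split; rewrite /ball /= sub0r normrN gtr0_norm //.
    exact: lt_trans sr.
  exact: lt_trans sr.
have := H1 _ (bl _ _ _ cs ds sd1).
have := H2 _ (bl _ _ _ ds' cs' sd2); rewrite /= [x + d' *: u + _]addrAC.
have -> : 'D_u ('D_v f) (x + c' *: v + d' *: u) = 'D_v ('D_u f) (x + c *: u + d *: v).
  have s20 : s ^+ 2 != 0 by rewrite expf_neq0 // lt0r_neq0.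
  apply: (mulfI s20); apply: (etrans (esym E2)); apply: etrans E1.
  by rewrite [x + s *: v + _]addrAC; ring.
move: ('D_v _ x) ('D_u _ x) ('D_v _ _) => a b m h1 h2.
rewrite (_ : a - b = (a - m) - (b - m)); last by ring.
apply: le_trans (ler_normB _ _) _.
by rewrite (splitr e); apply: lerD; exact: ltW.
Qed.

End Schwarz.

(** * Projective space in homogeneous coordinates *)

Section HermitianForms.
Context {R : realType} {m : nat}.
Implicit Types x y : Cvec R m.

(** [cre] and [cim] are the real and imaginary parts of the sum of [conj(x_k) y_k], and [cJ] is
    multiplication by i. *)
Definition cre x y : R := \sum_k (x k 0 * y k 0 + x k 1 * y k 1).
Definition cim x y : R := \sum_k (x k 0 * y k 1 - x k 1 * y k 0).
Definition cJ x : Cvec R m := \matrix_(k, b) (if b == 0 then - x k 1 else x k 0).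

Lemma sum2 (F : 'I_2 -> R) : \sum_(b < 2) F b = F 0 + F 1.
Proof.
rewrite !big_ord_recl big_ord0 addr0; congr (_ + F _).
exact: val_inj.
Qed.

Lemma ord2_case (P : 'I_2 -> Prop) : P 0 -> P 1 -> forall b, P b.
Proof.
move=> P0 P1 b; have [->//|/eqP b0] := b =P 0.
suff -> : b = 1 by [].
by apply: val_inj; case: b b0 => [[|[|]]] //= lt b0; case: b0; exact: val_inj.
Qed.

Lemma cmxP x y : (forall k, x k 0 = y k 0) -> (forall k, x k 1 = y k 1) -> x = y.
Proof. by move=> e0 e1; apply/matrixP => k; apply: ord2_case. Qed.

Lemma creE x y : cre x y = \sum_k \sum_b x k b * y k b.
Proof. by apply: eq_bigr => k _; rewrite sum2. Qed.

Lemma cJ0 x k : cJ x k 0 = - x k 1. Proof. by rewrite mxE. Qed.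
Lemma cJ1 x k : cJ x k 1 = x k 0. Proof. by rewrite mxE. Qed.

Lemma creC x y : cre x y = cre y x.
Proof. by apply: eq_bigr => k _; ring. Qed.
Lemma cimC x y : cim x y = - cim y x.
Proof. by rewrite -sumrN; apply: eq_bigr => k _; ring. Qed.
Lemma creDl x x' y : cre (x + x') y = cre x y + cre x' y.
Proof. by rewrite -big_split; apply: eq_bigr => k _ /=; rewrite !mxE; ring. Qed.
Lemma creZl a x y : cre (a *: x) y = a * cre x y.
Proof. by rewrite mulr_sumr; apply: eq_bigr => k _ /=; rewrite !mxE; ring. Qed.
Lemma creDr x y y' : cre x (y + y') = cre x y + cre x y'.
Proof. by rewrite -big_split; apply: eq_bigr => k _ /=; rewrite !mxE; ring. Qed.
Lemma creZr a x y : cre x (a *: y) = a * cre x y.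
Proof. by rewrite mulr_sumr; apply: eq_bigr => k _ /=; rewrite !mxE; ring. Qed.
Lemma cimDl x x' y : cim (x + x') y = cim x y + cim x' y.
Proof. by rewrite -big_split; apply: eq_bigr => k _ /=; rewrite !mxE; ring. Qed.
Lemma cimZl a x y : cim (a *: x) y = a * cim x y.
Proof. by rewrite mulr_sumr; apply: eq_bigr => k _ /=; rewrite !mxE; ring. Qed.
Lemma cimDr x y y' : cim x (y + y') = cim x y + cim x y'.
Proof. by rewrite -big_split; apply: eq_bigr => k _ /=; rewrite !mxE; ring. Qed.
Lemma cimZr a x y : cim x (a *: y) = a * cim x y.
Proof. by rewrite mulr_sumr; apply: eq_bigr => k _ /=; rewrite !mxE; ring. Qed.
Lemma cre_Jl x y : cre (cJ x) y = cim x y.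
Proof. by apply: eq_bigr => k _ /=; rewrite cJ0 cJ1; ring. Qed.
Lemma cre_Jr x y : cre x (cJ y) = - cim x y.
Proof. by rewrite -sumrN; apply: eq_bigr => k _ /=; rewrite cJ0 cJ1; ring. Qed.
Lemma cim_Jl x y : cim (cJ x) y = - cre x y.
Proof. by rewrite -sumrN; apply: eq_bigr => k _ /=; rewrite cJ0 cJ1; ring. Qed.
Lemma cim_Jr x y : cim x (cJ y) = cre x y.
Proof. by apply: eq_bigr => k _ /=; rewrite cJ0 cJ1; ring. Qed.
Lemma cim_id x : cim x x = 0.
Proof. by rewrite /cim big1 // => k _; ring. Qed.

Lemma cre_deltar x k b : cre x (delta_mx k b) = x k b.
Proof.
rewrite creE (bigD1 k) //= (bigD1 b) //= !mxE !eqxx mulr1 !big1 ?addr0 //.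
  move=> l lk; rewrite big1 // => c _; rewrite mxE (negPf lk) mulr0 //.
by move=> c cb; rewrite mxE eqxx (negPf cb) mulr0.
Qed.

Lemma cre_ge0 x : 0 <= cre x x.
Proof. by apply: sumr_ge0 => k _; rewrite -!expr2 addr_ge0 ?sqr_ge0. Qed.

Lemma cre_normsq x : cre x x = \sum_k normsq x k.
Proof. by apply: eq_bigr => k _; rewrite /normsq; ring. Qed.

Lemma cscaleE (a b : R) x : cscale (a +i* b) x = a *: x + b *: cJ x.
Proof.
by apply: cmxP => k; rewrite !mxE /= ?mulrN // addrC.
Qed.

Lemma cscale_eq0 (c : R[i]) x : c != 0 -> (cscale c x == 0) = (x == 0).
Proof.
case: c => a b; rewrite eq_complex /= => c0.
have N0 : a ^+ 2 + b ^+ 2 != 0.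
  apply: contra c0; rewrite paddr_eq0 ?sqr_ge0 // !sqrf_eq0 => /andP[/eqP-> /eqP->].
  by rewrite !eqxx.
apply/eqP/eqP => [/matrixP E|->]; last first.
  by rewrite cscaleE; apply: cmxP => k; rewrite !mxE /=; ring.
apply: cmxP => k; have := E k 0; have := E k 1; rewrite cscaleE !mxE /= => e1 e0;
  apply: (mulfI N0).
  (* Multiplying [c x = 0] by the conjugate of [c] leaves [|c|^2 x]. *)
  transitivity (a * (a * x k 0 + b * - x k 1) + b * (a * x k 1 + b * x k 0)); first by ring.
  by rewrite e0 e1; ring.
transitivity (a * (a * x k 1 + b * x k 0) - b * (a * x k 0 + b * - x k 1)); first by ring.
by rewrite e0 e1; ring.
Qed.

Lemma cscaleA (c d : R[i]) x : cscale c (cscale d x) = cscale (c * d) x.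
Proof.
case: c d => a b [c d].
have -> : (a +i* b) * (c +i* d) = (a * c - b * d) +i* (a * d + b * c) by [].
rewrite !cscaleE.
by apply: cmxP => k; rewrite !mxE /=; ring.
Qed.

Lemma cscale1 x : cscale 1 x = x.
Proof. by rewrite (cscaleE 1 0) scale1r scale0r addr0. Qed.

End HermitianForms.

(** * Affine charts and the pullback of functions to homogeneous coordinates *)

Section Projective.
Context {R : realType} {n : nat}.
Implicit Types (z : Cvec R n.+1) (p : CP R n) (f g : smoothfn R n).

Lemma CP_inj p p' : CP_class p = CP_class p' -> p = p'.
Proof.
case: p p' => [A hA] [B hB] /= AB; move: hB; rewrite -AB => hB.
by congr MkCP; exact: Prop_irrelevance.
Qed.

Lemma nz_repE z : z != 0 -> nz_rep z = z.
Proof. by rewrite /nz_rep => /negPf ->. Qed.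

Lemma Cline_scale (c : R[i]) z : c != 0 -> Cline (cscale c z) = Cline z.
Proof.
move=> c0; apply/seteqP; split=> _ [d /= d0 <-].
  by exists (d * c); rewrite /= ?mulf_neq0 // cscaleA.
by exists (d / c); rewrite /= ?mulf_neq0 ?invr_eq0 // cscaleA mulfVK.
Qed.

Lemma proj_scale (c : R[i]) z : c != 0 -> proj (cscale c z) = proj z.
Proof.
move=> c0; apply: CP_inj => /=; have [->|z0] := eqVneq z 0.
  by congr (Cline (nz_rep _)); apply/eqP; rewrite cscale_eq0.
by rewrite !nz_repE ?cscale_eq0 // Cline_scale.
Qed.

Lemma proj_scaler (t : R) z : t != 0 -> proj (t *: z) = proj z.
Proof.
move=> t0; rewrite -[in RHS](proj_scale (c := t +i* 0)).
  by rewrite cscaleE scale0r addr0.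
by rewrite eq_complex /= negb_and t0.
Qed.

Lemma proj_eq z z' : z != 0 -> z' != 0 -> proj z = proj z' ->
  exists2 c : R[i], c != 0 & cscale c z = z'.
Proof.
move=> z0 z0' /(congr1 (@CP_class _ _)) /=; rewrite !nz_repE // => E.
have [c /= c0 cE] : Cline z z'.
  by rewrite E; exists 1; rewrite /= ?oner_neq0 // cscale1.
by exists c.
Qed.

Lemma projP p : exists2 z, z != 0 & p = proj z.
Proof.
case: p => A hA; have [z z0 AE] := hA; exists z => //.
by apply: CP_inj; rewrite /= nz_repE.
Qed.

Definition homog (j : 'I_n.+1) (w : Cvec R n) : Cvec R n.+1 :=
  \matrix_(l, b) (if unlift j l is Some k then w k b else (b == 0)%:R).

Lemma affineE j w : affine j w = proj (homog j w). Proof. by []. Qed.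

Lemma homog_lift j w k b : homog j w (lift j k) b = w k b.
Proof. by rewrite mxE liftK. Qed.
Lemma homog_id j w b : homog j w j b = (b == 0)%:R.
Proof. by rewrite mxE unlift_none. Qed.

Lemma homog_neq0 j w : homog j w != 0.
Proof.
apply/eqP => /matrixP/(_ j 0); rewrite homog_id mxE /=.
by apply/eqP; rewrite oner_neq0.
Qed.

(* The affine coordinates z_k / z_j *)
Definition ratio (j : 'I_n.+1) z : Cvec R n :=
  \matrix_(k, b) (if b == 0
    then (z (lift j k) 0 * z j 0 + z (lift j k) 1 * z j 1) * (normsq z j)^-1
    else (z (lift j k) 1 * z j 0 - z (lift j k) 0 * z j 1) * (normsq z j)^-1).

(** The scalar is [1 / z_j], written as [conj(z_j) / |z_j|^2]. *)
Lemma homog_ratio j z : normsq z j != 0 ->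
  cscale ((z j 0 * (normsq z j)^-1) +i* (- (z j 1 * (normsq z j)^-1))) z =
  homog j (ratio j z).
Proof.
move=> N0; rewrite cscaleE; apply: cmxP => l; rewrite !mxE /=;
  case: unliftP => [k ->|->]; rewrite ?mxE /=; rewrite /normsq in N0 *;
  by field.
Qed.

Lemma proj_affine j z : normsq z j != 0 -> proj z = affine j (ratio j z).
Proof.
move=> N0; rewrite affineE -homog_ratio // proj_scale // eq_complex /= negb_and.
rewrite oppr_eq0 -negb_and; apply: contra N0 => /andP[].
rewrite !mulf_eq0 !invr_eq0 /normsq.
by case: eqP => [->/=|_ /=]; [case: eqP => [->|]|]; rewrite ?expr0n ?addr0 ?eqxx.
Qed.

Lemma normsq_neq0 z : z != 0 -> exists j, normsq z j != 0.
Proof.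
move=> z0; apply: contrapT => /forallNP N; case/eqP: z0; apply: cmxP => l;
  have /negP/negPn := N l; rewrite /normsq paddr_eq0 ?sqr_ge0 // !sqrf_eq0;
  by case/andP => /eqP e0 /eqP e1; rewrite mxE.
Qed.

Lemma CP_affine p : exists j w, p = affine j w.
Proof.
have [z z0 ->] := projP p; have [j Nj] := normsq_neq0 z0.
by exists j, (ratio j z); exact: proj_affine.
Qed.

Lemma smoothfnP f j : smooth_on setT (f \o affine j).
Proof. by case: f. Qed.

Lemma Ck_normsq (U : set (Cvec R n.+1)) k j : open U ->
  Ck_on U k (fun z => normsq z j).
Proof.
move=> oU; rewrite /normsq.
by under eq_fun do rewrite !expr2; apply: Ck_onD => //; apply: Ck_onM => //;
  exact: Ck_on_coord.
Qed.

Lemma open_normsq j : open [set z : Cvec R n.+1 | normsq z j != 0].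
Proof.
have c : continuous (fun z : Cvec R n.+1 => normsq z j).
  by move=> z; exact: (@Ck_normsq setT 0%N j openT z).
exact: (@open_comp _ _ (fun z => normsq z j) [set x | x != 0]) (fun z _ => c z) (@open_neq R 0).
Qed.

(** Where [z_j] is nonzero the pullback is a chart expression composed with the rational functions
    [ratio j]; these open sets cover the complement of 0. *)
Lemma smooth_proj f : smooth_on [set z : Cvec R n.+1 | z != 0] (f \o proj).
Proof.
move=> k; apply: (@sub_Ck_on _ _ (\bigcup_j [set z | normsq z j != 0])).
  by move=> z /= /normsq_neq0 [j Nj]; exists j.
apply: Ck_on_bigcup => j; have oU := @open_normsq j.
have H : Ck_on [set z | normsq z j != 0] k ((f \o affine j) \o ratio j).
  apply: Ck_on_comp => //; last exact: smoothfnP.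
  move=> i b; have NV : Ck_on [set z : Cvec R n.+1 | normsq z j != 0] k
      (fun z => (normsq z j)^-1) by apply: Ck_onV => //; exact: Ck_normsq.
  under [X in Ck_on _ _ X]eq_fun do rewrite mxE.
  by case: (b == 0); (apply: Ck_onM => //; apply: Ck_onD => //; try apply: Ck_onN => //;
    apply: Ck_onM => //; exact: Ck_on_coord).
by apply: eq_Ck_on H => // z /= Nj; rewrite (proj_affine Nj).
Qed.

Lemma diff_proj f z : z != 0 -> differentiable (f \o proj) z.
Proof. exact: smooth_on_diff (smooth_proj f). Qed.

Lemma diff_affine f j w : differentiable (f \o affine j) w.
Proof. exact: smooth_on_diff (smoothfnP f j) _. Qed.

Definition grad f j (w : Cvec R n) : Cvec R n :=
  \matrix_(k, b) 'D_(delta_mx k b) (f \o affine j) w.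

Lemma derive_affine f j w v : 'D_v (f \o affine j) w = cre v (grad f j w).
Proof.
rewrite derive_delta ?creE; last exact: diff_affine.
by apply: eq_bigr => k _; apply: eq_bigr => b _; rewrite mxE.
Qed.

Lemma derive_cst_line (F : Cvec R n.+1 -> R) z v :
  (\forall t \near (0 : R), F (t *: v + z) = F z) -> 'D_v F z = 0.
Proof.
move=> Fc; rewrite /derive; apply: lim_near_cst => //.
apply: cvg_within; near=> t; rewrite /=.
have -> : F (t *: v + z) = F z by near: t.
by rewrite subrr scaler0.
Unshelve. all: by end_near. Qed.

(** Moving a coordinate other than [z_j] stays in the slice [z_j = 1], where the pullback is the
    chart expression itself. *)
Lemma derive_proj_lift f j w k b :
  'D_(delta_mx (lift j k) b) (f \o proj) (homog j w) = grad f j w k b.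
Proof.
rewrite mxE /derive; under eq_fun do rewrite /=.
have E (t : R) : proj (t *: delta_mx (lift j k) b + homog j w) =
    affine j (t *: delta_mx k b + w).
  rewrite affineE; congr proj; apply/matrixP => l c; rewrite !mxE.
  case: unliftP => [k' ->|->]; first by rewrite !mxE (inj_eq lift_inj).
  by rewrite (negPf (neq_lift _ _)) mulr0 add0r.
by under eq_fun do rewrite E.
Qed.

Lemma derive_proj_split f j w v :
  'D_v (f \o proj) (homog j w) =
  v j 0 * 'D_(delta_mx j 0) (f \o proj) (homog j w) +
  v j 1 * 'D_(delta_mx j 1) (f \o proj) (homog j w) +
  \sum_k (v (lift j k) 0 * grad f j w k 0 + v (lift j k) 1 * grad f j w k 1).
Proof.
rewrite derive_delta; last exact/diff_proj/homog_neq0.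
rewrite (bigD1_ord j) //; congr (_ + _); first by rewrite sum2.
by apply: eq_bigr => k _; rewrite sum2 !derive_proj_lift.
Qed.

(* The pullback of [f] is annihilated by the Euler field of the C^*-action and
   by its rotation by i; this determines the derivatives along z_j. *)
Lemma derive_proj_re f j w :
  'D_(delta_mx j 0) (f \o proj) (homog j w) = - cre w (grad f j w).
Proof.
have : 'D_(homog j w) (f \o proj) (homog j w) = 0.
  apply: derive_cst_line; near=> t => /=.
  (* A step along the Euler field multiplies the point by [1 + t], which has to stay nonzero for the
     class to be unchanged. *)
  have t1 : 1 + t != 0.
    have : `|t| < 1 by near: t; exact: (@pseudometric_normed_Zmodule.nbhs0_lt R R 1 ltr01).
    by rewrite ltr_norml => /andP[t1 _]; rewrite gt_eqF // -ltrBlDl sub0r.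
  rewrite -[in RHS](proj_scaler _ t1); congr (f (proj _)).
  by rewrite scalerDl scale1r addrC.
rewrite derive_proj_split !homog_id /= mul1r mul0r addr0.
by under eq_bigr do rewrite !homog_lift; move/eqP; rewrite addr_eq0 => /eqP.
Unshelve. all: by end_near. Qed.

Lemma derive_proj_im f j w :
  'D_(delta_mx j 1) (f \o proj) (homog j w) = - cim w (grad f j w).
Proof.
have : 'D_(cJ (homog j w)) (f \o proj) (homog j w) = 0.
  apply: derive_cst_line; near=> t => /=.
  have t1 : (1 +i* t : R[i]) != 0 by rewrite eq_complex /= negb_and oner_neq0.
  rewrite -[in RHS](proj_scale _ t1) cscaleE; congr (f (proj _)).
  by rewrite scale1r addrC.
rewrite derive_proj_split cJ0 cJ1 !homog_id /= oppr0 mul1r mul0r add0r.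
under eq_bigr do rewrite cJ0 cJ1 !homog_lift.
rewrite (_ : \sum_k _ = cim w (grad f j w)); last by apply: eq_bigr => k _; ring.
by move/eqP; rewrite addr_eq0 => /eqP.
Unshelve. all: by end_near. Qed.

End Projective.

(** * Hamiltonian vector fields and the symplectic form in a chart *)

Section TestFunctions.
Context {R : realType} {n : nat}.
Implicit Types (z : Cvec R n.+1) (w v c : Cvec R n) (f g : smoothfn R n).

(* |z|^2 / |z_j|^2 in the chart j *)
Definition fs (w : Cvec R n) : R := 1 + cre w w.

Lemma fs_gt0 w : 0 < fs w.
Proof. by rewrite ltr_pwDl // cre_ge0. Qed.

Lemma fs_neq0 w : fs w != 0.
Proof. exact/lt0r_neq0/fs_gt0. Qed.

(* In the chart j, where z_j = 1, this is c . w + d. *)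
Definition test_num (j : 'I_n.+1) c (d : R) z : R :=
  \sum_k (c k 0 * (z (lift j k) 0 * z j 0 + z (lift j k) 1 * z j 1) +
          c k 1 * (z (lift j k) 1 * z j 0 - z (lift j k) 0 * z j 1)) +
  d * normsq z j.

(** Numerator and [|z|^2] are both real Hermitian forms and scale by [|e|^2], so their quotient
    descends to projective space. *)
Lemma test_num_scale j c d (e : R[i]) z :
  test_num j c d (cscale e z) =
  (complex.Re e ^+ 2 + complex.Im e ^+ 2) * test_num j c d z.
Proof.
case: e => a b /=; rewrite cscaleE /test_num [RHS]mulrDr mulr_sumr /normsq.
congr (_ + _); last by rewrite !mxE /=; ring.
by apply: eq_bigr => k _; rewrite !mxE /=; ring.
Qed.

Lemma cre_scale (e : R[i]) z :
  cre (cscale e z) (cscale e z) =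
  (complex.Re e ^+ 2 + complex.Im e ^+ 2) * cre z z.
Proof.
case: e => a b /=; rewrite cscaleE.
rewrite !(creDl, creDr, creZl, creZr) !(cre_Jl, cre_Jr, cim_Jr) cim_id.
by ring.
Qed.

Lemma cre_gt0 z : z != 0 -> 0 < cre z z.
Proof.
move=> /normsq_neq0[j Nj]; rewrite lt0r cre_ge0 andbT cre_normsq.
apply: contra Nj; rewrite psumr_eq0.
  by move=> /allP /(_ j); rewrite mem_index_enum => /(_ isT).
by move=> l _; rewrite /normsq addr_ge0 ?sqr_ge0.
Qed.

Definition CP_rep (p : CP R n) : Cvec R n.+1 := s2val (cid2 (projP p)).

Lemma CP_rep_neq0 p : CP_rep p != 0.
Proof. by rewrite /CP_rep; case: cid2. Qed.

Lemma proj_CP_rep p : proj (CP_rep p) = p.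
Proof. by rewrite /CP_rep; case: cid2. Qed.

Definition test_fun j c d (p : CP R n) : R :=
  test_num j c d (CP_rep p) / cre (CP_rep p) (CP_rep p).

Lemma test_funE j c d z : z != 0 ->
  test_fun j c d (proj z) = test_num j c d z / cre z z.
Proof.
move=> z0; rewrite /test_fun; have r0 := CP_rep_neq0 (proj z).
have := proj_eq r0 z0 (proj_CP_rep _); move: (CP_rep _) r0 => r r0 [e e0 zE].
have cr0 := lt0r_neq0 (cre_gt0 r0).
have := lt0r_neq0 (cre_gt0 z0); rewrite -zE cre_scale test_num_scale.
rewrite mulf_eq0 negb_or => /andP[e1 _].
by field; rewrite e1 cr0.
Qed.

Lemma cre_homog j w : cre (homog j w) (homog j w) = fs w.
Proof.
rewrite /cre (bigD1_ord j) // /fs; congr (_ + _).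
  by rewrite !homog_id /=; ring.
by apply: eq_bigr => k _; rewrite !homog_lift.
Qed.

Lemma test_fun_affine j c d w : test_fun j c d (affine j w) = (cre c w + d) / fs w.
Proof.
rewrite affineE test_funE ?homog_neq0 // cre_homog; congr (_ / _).
rewrite /test_num /normsq !homog_id /=; congr (_ + _); last by ring.
by apply: eq_bigr => k _; rewrite !homog_lift; ring.
Qed.

Lemma Ck_test_num j c d k : Ck_on setT k (test_num j c d).
Proof.
have oT : open [set: Cvec R n.+1] by exact: openT.
rewrite /test_num; apply: Ck_onD => //.
  apply: Ck_on_sum => // i; apply: Ck_onD => //; apply: Ck_onM => //;
    try exact: Ck_on_cst; apply: Ck_onD => //; try apply: Ck_onN => //;
    by apply: Ck_onM => //; exact: Ck_on_coord.
by apply: Ck_onM => //; [exact: Ck_on_cst|exact: Ck_normsq].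
Qed.

Lemma test_fun_smooth j c d i : smooth_on setT (test_fun j c d \o affine i).
Proof.
move=> k; have oT : open [set: Cvec R n] by exact: openT.
have hk l b : Ck_on setT k (fun w : Cvec R n => homog i w l b).
  under [X in Ck_on _ _ X]eq_fun do rewrite mxE.
  by case: unliftP => [m _|_]; [exact: Ck_on_coord|exact: Ck_on_cst].
have H : Ck_on setT k (fun w => (test_num j c d \o homog i) w *
    ((\sum_l normsq (homog i w) l))^-1).
  apply: Ck_onM => //; first exact: Ck_on_comp (Ck_test_num _ _ _ _).
  apply: Ck_onV => //.
    by move=> w _; rewrite -cre_normsq cre_homog fs_neq0.
  apply: Ck_on_sum => // l.
  exact: Ck_on_comp (@Ck_normsq _ _ setT k l openT).
apply: eq_Ck_on H => // w _ /=.
by rewrite -cre_normsq affineE test_funE ?homog_neq0.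
Qed.

Lemma is_derive_cre c v w : is_derive w v (cre c) (cre c v).
Proof.
rewrite /cre; apply: is_derive_big => k.
have d b := is_deriveZ (c k b) (is_derive_coord k b w v).
exact: is_deriveD (d 0) (d 1).
Qed.

Lemma is_derive_fs v w : is_derive w v fs (2 * cre w v).
Proof.
have d k b := is_deriveM (is_derive_coord k b w v) (is_derive_coord k b w v).
have ds k := is_deriveD (d k 0) (d k 1).
have D := is_deriveD (is_derive_cst (1 : R) w v) (is_derive_big (index_enum _) xpredT ds).
apply: (is_derive_eq D); rewrite add0r mulr_sumr; apply: eq_bigr => k _.
by rewrite /GRing.scale /=; ring.
Qed.

(** Every covector at a point is the differential of a global function, so derivations of global
    functions see all chart components. *)
Lemma exists_grad j w c : exists f, grad f j w = c.
Proof.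
(* The constant term makes the numerator vanish at [w], so the denominator is not differentiated;
   the factor [fs w] cancels the division. *)
pose f := SmoothFn (test_fun_smooth j (fs w *: c) (- cre (fs w *: c) w)).
exists f; apply/matrixP => k b; rewrite mxE.
have -> : f \o affine j = fun w' => (cre (fs w *: c) w' +
    (- cre (fs w *: c) w)) * (fs w')^-1.
  by apply/funext => w'; rewrite /= test_fun_affine.
have d1 := is_deriveD (is_derive_cre (fs w *: c) (delta_mx k b) w)
   (is_derive_cst (- cre (fs w *: c) w) w (delta_mx k b)).
have d2 := is_derive_fs (delta_mx k b) w.
have w0 := fs_neq0 w.
rewrite [LHS](@deriveM _ _ _ (fun w' => (fs w')^-1)); last 2 first.
- exact: ex_derive.
- by apply: derivableV => //; exact: ex_derive.
rewrite [X in _ *: X + _](@deriveV _ _ fs); last 2 first.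
- by [].
- exact: ex_derive.
rewrite !derive_val addrN scale0r add0r addr0 /GRing.scale /= cre_deltar mxE.
by rewrite mulrA mulVf ?mul1r.
Qed.

Lemma chart_vec_inj j w v v' : chart_vec j w v = chart_vec j w v' -> v = v'.
Proof.
move=> E; apply/matrixP => k b.
have [f fE] := exists_grad j w (delta_mx k b).
by have := congr1 (@^~ f) E; rewrite /chart_vec !derive_affine fE !cre_deltar.
Qed.

(** [components] is a choice with default 0; existence and uniqueness of the component vector make
    it computable here. *)
Lemma componentsE j w v : components j w (chart_vec j w v) = v.
Proof.
have := @xgetPex _ 0 [set v' | chart_vec j w v = chart_vec j w v']
  (ex_intro _ v erefl).
by move=> /= /chart_vec_inj/esym.
Qed.

End TestFunctions.

(** * Both Poisson structures in a chart, and the inverse of the nondegenerate one *)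

Section Brackets.
Context {R : realType} {n : nat}.
Implicit Types (w v : Cvec R n) (f g : smoothfn R n).
Implicit Type B : smoothfn R n -> smoothfn R n -> smoothfn R n.

Lemma bivectorE m (a : Cvec R m -> 'I_m -> R) F G z :
  bivector a F G z = \sum_l a z l / 2 *
     ('D_(delta_mx l 0) F z * 'D_(delta_mx l 1) G z -
      'D_(delta_mx l 1) F z * 'D_(delta_mx l 0) G z).
Proof. by rewrite /bivector cbivectorE. Qed.

(** The derivatives along [z_j] are minus the real and imaginary parts of [<w, grad>]; they enter in
    products of two, where the signs cancel. *)
Lemma bivector_homog (a : Cvec R n.+1 -> 'I_n.+1 -> R) f g j w :
  bivector a (f \o proj) (g \o proj) (homog j w) =
  a (homog j w) j / 2 * (cre w (grad f j w) * cim w (grad g j w) -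
                         cim w (grad f j w) * cre w (grad g j w)) +
  \sum_k a (homog j w) (lift j k) / 2 *
    (grad f j w k 0 * grad g j w k 1 - grad f j w k 1 * grad g j w k 0).
Proof.
rewrite bivectorE (bigD1_ord j) //; congr (_ + _).
  by rewrite !derive_proj_re !derive_proj_im !mulrNN.
by apply: eq_bigr => k _; rewrite !derive_proj_lift.
Qed.

Definition toric_vec w (c : Cvec R n) : Cvec R n :=
  \matrix_(k, b) (if b == 0
    then - (2^-1 * (normsq w k * c k 1 + cre w c * w k 1 + cim w c * w k 0))
    else 2^-1 * (normsq w k * c k 0 + cre w c * w k 0 - cim w c * w k 1)).

Lemma toric_vec0 w c k : toric_vec w c k 0 =
  - (2^-1 * (normsq w k * c k 1 + cre w c * w k 1 + cim w c * w k 0)).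
Proof. by rewrite mxE. Qed.

Lemma toric_vec1 w c k : toric_vec w c k 1 =
  2^-1 * (normsq w k * c k 0 + cre w c * w k 0 - cim w c * w k 1).
Proof. by rewrite mxE. Qed.

Lemma cre_toric_vec w c e : cre (toric_vec w c) e =
  2^-1 * (cre w c * cim w e - cim w c * cre w e) +
  \sum_k normsq w k / 2 * (c k 0 * e k 1 - c k 1 * e k 0).
Proof.
rewrite [LHS]/cre; under eq_bigr do rewrite toric_vec0 toric_vec1.
move: (cre w c) (cim w c) => a b; rewrite /cre /cim !mulr_sumr -sumrB mulr_sumr.
by rewrite -big_split; apply: eq_bigr => k _ /=; field.
Qed.

Lemma toric_hamE B f j w : is_toric_poisson B ->
  value_at (B f) (affine j w) = chart_vec j w (toric_vec w (grad f j w)).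
Proof.
move=> [_ BE]; apply/funext => g; rewrite /value_at /chart_vec affineE -BE.
  rewrite derive_affine cre_toric_vec /toric_bracket bivector_homog.
  rewrite {1}/normsq !homog_id /= expr1n expr0n addr0 mul1r; congr (_ + _).
  by apply: eq_bigr => k _; rewrite /normsq !homog_lift.
exact: homog_neq0.
Qed.

(** The pullback is homogeneous of degree 0, hence its derivatives are of degree -1. This carries
    computations on [Zlevel] back to the slice [z_j = 1]. *)
Lemma derive_proj_scale f j w (v : Cvec R n.+1) (t : R) : t != 0 ->
  'D_v (f \o proj) (t *: homog j w) = t^-1 * 'D_v (f \o proj) (homog j w).
Proof.
move=> t0; transitivity ('D_(t^-1 *: v) (f \o proj) (homog j w)).
  rewrite /derive; under eq_fun => s do rewrite /= (proj_scaler _ t0).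
  have E (s : R) : proj (s *: v + t *: homog j w) =
      proj (s *: (t^-1 *: v) + homog j w).
    rewrite -[RHS](proj_scaler _ t0); congr proj.
    by rewrite scalerDr !scalerA; congr (_ *: _ + _); field.
  by under eq_fun => s do rewrite E.
have fd := diff_proj f (homog_neq0 j w).
by rewrite !deriveE // linearZ.
Qed.

Definition delzant_vec w (c : Cvec R n) : Cvec R n :=
  (pi * fs w) *: (cJ c + cre w c *: cJ w - cim w c *: w).

Lemma cre_delzant_vec w c e : cre (delzant_vec w c) e =
  pi * fs w * (cim c e + cre w c * cim w e - cim w c * cre w e).
Proof.
by rewrite /delzant_vec creZl -scaleNr !creDl !creZl !cre_Jl mulNr.
Qed.

Lemma planck_gt0 (h : R) : 0 < h -> 0 < planck h.
Proof. by move=> h0; rewrite divr_gt0 // mulr_gt0 // pi_gt0. Qed.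

(** The positive factor that moves [homog j w] onto [Zlevel h], since [|homog j w|^2 = fs w]. *)
Definition zscale (h : R) w : R := Num.sqrt (planck h / fs w).

Lemma zscale_sqr (h : R) w : 0 < h -> zscale h w ^+ 2 = planck h / fs w.
Proof. by move=> h0; rewrite sqr_sqrtr // ltW // divr_gt0 ?planck_gt0 ?fs_gt0. Qed.

Lemma zscale_neq0 h w : 0 < h -> zscale h w != 0.
Proof.
by move=> h0; rewrite lt0r_neq0 // sqrtr_gt0 divr_gt0 ?planck_gt0 ?fs_gt0.
Qed.

Lemma Zlevel_homog h j w : 0 < h -> Zlevel h (zscale h w *: homog j w).
Proof.
move=> h0; rewrite /Zlevel /= -cre_normsq creZl creZr cre_homog mulrA -expr2.
by rewrite zscale_sqr // mulfVK ?fs_neq0 // mulVf // lt0r_neq0 // planck_gt0.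
Qed.

(** The pullback is invariant under all of C^*, in particular under the circle, so the reduced
    bracket can be computed from the same derivatives as the toric one. *)
Lemma invariant_extension_proj h f : invariant_extension h f (f \o proj).
Proof.
split=> //; first exact: smooth_proj.
move=> c z c1 /=; rewrite proj_scale // -normr_gt0 c1; exact: ltr01.
Qed.

Lemma delzant_hamE B h f j w : 0 < h -> is_delzant_poisson h B ->
  value_at (B f) (affine j w) = chart_vec j w (delzant_vec w (grad f j w)).
Proof.
move=> h0 [_ [B0 [_ B0E] BE]]; apply/funext => g.
rewrite /value_at /chart_vec derive_affine BE.
have t0 := zscale_neq0 w h0; set t := zscale h w in t0.
rewrite affineE -(proj_scaler _ t0).
rewrite (B0E _ _ _ _ (invariant_extension_proj h f) (invariant_extension_proj h g));
  last exact: Zlevel_homog.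
(* The flat bracket has constant coefficients and is bilinear in first derivatives, each of degree
   -1. *)
have -> : flat_bracket (f \o proj) (g \o proj) (t *: homog j w) =
    (t ^+ 2)^-1 * flat_bracket (f \o proj) (g \o proj) (homog j w).
  rewrite /flat_bracket !bivectorE mulr_sumr; apply: eq_bigr => l _.
  rewrite !derive_proj_scale //.
  move: ('D_(delta_mx l 0) (f \o proj) (homog j w))
    ('D_(delta_mx l 1) (f \o proj) (homog j w))
    ('D_(delta_mx l 0) (g \o proj) (homog j w))
    ('D_(delta_mx l 1) (g \o proj) (homog j w)) => a b a' b'.
  by field.
rewrite /flat_bracket bivector_homog cre_delzant_vec -mulr_sumr -/(cim _ _).
(* The coefficient is [h * t^-2 / 2 = h q / (2 hbar) = pi q], which no longer involves [h]. *)
rewrite /t zscale_sqr // /planck.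
move: (grad f j w) (grad g j w) => c e.
move: (cre w c) (cim w c) (cre w e) (cim w e) (cim c e) => {c e} a b a' b' e.
have p0 : (pi : R) != 0 by rewrite lt0r_neq0 // pi_gt0.
by move: (@pi R) p0 => P p0; field; rewrite p0 fs_neq0 lt0r_neq0.
Qed.

(** The Fubini-Study form [Im (<v, v'> - <v, w> <w, v'> / q) / (pi q)]. *)
Definition fs_form w v v' : R :=
  (pi * fs w)^-1 *
  (cim v v' - (cre v w * cim w v' + cim v w * cre w v') / fs w).

Lemma symplectic_formE B h (om : CP R n -> tvec R n -> tvec R n -> R) j w v v' :
  0 < h -> is_delzant_poisson h B -> is_symplectic_form_of B om ->
  om (affine j w) (chart_vec j w v) (chart_vec j w v') = fs_form w v v'.
Proof.
move=> h0 dB [_ omE].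
(* The solution of [pi q i (c + <w, c> w) = v]: pairing with [w] gives
   [<w, c> = <w, v> / (i pi q^2)], whence [c = - i (v - <w, v> w / q) / (pi q)]. *)
pose c v := (- (pi * fs w)^-1) *:
  (cJ v - (fs w)^-1 *: (cre w v *: cJ w - cim w v *: w)).
have p0 : (pi : R) != 0 by rewrite lt0r_neq0 // pi_gt0.
have q0 := fs_neq0 w.
have qE : cre w w = fs w - 1 by rewrite /fs addrC addKr.
have vecE x : delzant_vec w (c x) = x.
  have e1 : cre w (c x) = (pi * fs w)^-1 * cim w x / fs w.
    rewrite /c -!scaleNr !(creZr, creDr, cre_Jr) cim_id qE.
    by move: (@pi R) p0 => P p0; field; rewrite p0 q0.
  have e2 : cim w (c x) = (pi * fs w)^-1 * (cre w x * -1) / fs w.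
    rewrite /c -!scaleNr !(cimZr, cimDr, cim_Jr) cim_id qE.
    by move: (@pi R) p0 => P p0; field; rewrite p0 q0.
  rewrite /delzant_vec e1 e2 /c; move: (cre w x) (cim w x) => a b.
  by move: (@pi R) p0 => P p0; apply: cmxP => k; rewrite !mxE /=;
    move: (fs w) q0 (x k 0) (x k 1) (w k 0) (w k 1) => q q0 x0 x1 w0 w1;
    field; rewrite p0 q0.
(* Functions whose Hamiltonian vectors at the point are [v] and [v'], so that the form can be read
   off from their bracket. *)
have [f fE] := exists_grad j w (c v); have [g gE] := exists_grad j w (c v').
have vf : value_at (B f) (affine j w) = chart_vec j w v.
  by rewrite -[in RHS](vecE v) -fE; exact: delzant_hamE h0 dB.
have vg : value_at (B g) (affine j w) = chart_vec j w v'.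
  by rewrite -[in RHS](vecE v') -gE; exact: delzant_hamE h0 dB.
rewrite -vf -vg omE -[LHS]/(value_at (B f) (affine j w) g) vf /chart_vec.
rewrite derive_affine gE /c -!scaleNr !(creZr, creDr, cre_Jr) /fs_form.
by move: (@pi R) p0 => P p0; field; rewrite p0 q0.
Qed.

End Brackets.

(** * Pfaffians *)

Section DeriveExtra.
Context {R : realType} {V : normedModType R}.
Implicit Types (x v : V).

Lemma is_derive_prod m (f : 'I_m -> V -> R) x v (df : 'I_m -> R) :
  (forall i, is_derive x v (f i) (df i)) ->
  is_derive x v (fun y => \prod_i f i y)
    (\sum_i df i * \prod_(j | j != i) f j x).
Proof.
elim: m f df => [|m IH] f df fd.
  rewrite big_ord0; under eq_fun do rewrite big_ord0; exact: is_derive_cst.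
under eq_fun do rewrite big_ord_recl.
have D := is_deriveM (fd ord0) (IH _ _ (fun i => fd (lift ord0 i))).
apply: (is_derive_eq D); rewrite big_ord_recl [LHS]addrC; congr (_ + _).
  rewrite /GRing.scale /= mulrC; congr (_ * _).
  by rewrite [RHS]big_mkcond big_ord_recl /= mul1r.
rewrite /GRing.scale /= mulr_sumr; apply: eq_bigr => i _.
rewrite [in RHS]big_mkcond big_ord_recl /= mulrCA; congr (_ * (_ * _)).
rewrite [LHS]big_mkcond; apply: eq_bigr => j _.
by rewrite (inj_eq lift_inj).
Qed.

Lemma is_derive_inv (f : V -> R) x v (df : R) : f x != 0 ->
  is_derive x v f df ->
  is_derive x v (fun y => (f y)^-1) (- df / f x ^+ 2).
Proof.
move=> f0 fd; apply: DeriveDef; first by apply: derivableV.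
by rewrite (@deriveV _ _ f) // derive_val /GRing.scale /= mulNr mulrC mulNr.
Qed.

End DeriveExtra.

Lemma sum_pair2 {R : realType} n (F : 'I_n * 'I_2 -> R) :
  \sum_a F a = \sum_k (F (k, 0) + F (k, 1)).
Proof.
transitivity (\sum_a F (a.1, a.2)); first by apply: eq_bigr => -[].
rewrite -(pair_bigA _ (fun k b => F (k, b))) /=.
by apply: eq_bigr => k _; rewrite sum2.
Qed.

Section Pfaffian.
Context {R : realType} {n : nat}.
Local Notation I := ('I_n * 'I_2)%type.
Implicit Types (Om B : I -> I -> R) (s : {perm I}).

(* n! 2^n times the Pfaffian when Om is alternating *)
Definition pf Om : R :=
  \sum_(s : {perm I}) (-1) ^+ s * \prod_(k < n) Om (s (k, 0)) (s (k, 1)).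

Definition subst1 (d c x : I) : I := if x == d then c else x.

(** The substitution makes [c] and [d] indistinguishable, so composing [s] with their transposition
    preserves the product and reverses the sign: two equal rows and columns. *)
Lemma pf_subst1_neq Om c d : c != d ->
  \sum_(s : {perm I}) (-1) ^+ s *
    \prod_(k < n) Om (subst1 d c (s (k, 0))) (subst1 d c (s (k, 1))) = 0.
Proof.
move=> cd; set S := LHS; suff : S = - S.
  by move/eqP; rewrite -addr_eq0 -mulr2n mulrn_eq0 /= => /eqP.
have mt x : subst1 d c (tperm c d x) = subst1 d c x.
  by rewrite /subst1; case: tpermP => [->|->|_ _] //;
    rewrite ?eqxx ?(negPf cd).
rewrite {1}/S (reindex_inj (mulIg (tperm c d))) -sumrN; apply: eq_bigr => s _.
rewrite odd_permM odd_tperm cd addbT signrN mulNr; congr (- (_ * _)).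
by apply: eq_bigr => k _; rewrite !permM !mt.
Qed.

(** A permutation takes each value [d] at exactly one position, so the Leibniz rule over factors
    amounts to replacing one index at a time. *)
Lemma sum_prod_subst1 Om B s :
  \sum_k (\sum_c (B c (s (k, 0)) * Om c (s (k, 1)) +
                  B c (s (k, 1)) * Om (s (k, 0)) c)) *
    \prod_(l | l != k) Om (s (l, 0)) (s (l, 1)) =
  \sum_d \sum_c B c d *
    \prod_(k < n) Om (subst1 d c (s (k, 0))) (subst1 d c (s (k, 1))).
Proof.
rewrite [RHS](reindex_inj (@perm_inj _ s)) /=.
rewrite sum_pair2; apply: eq_bigr => k _.
rewrite -big_split mulr_suml; apply: eq_bigr => c _ /=.
have P b : \prod_(l < n | l != k)
    Om (subst1 (s (k, b)) c (s (l, 0))) (subst1 (s (k, b)) c (s (l, 1))) =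
    \prod_(l | l != k) Om (s (l, 0)) (s (l, 1)).
  apply: eq_bigr => l lk; rewrite /subst1 !(inj_eq perm_inj) !xpair_eqE.
  by rewrite (negPf lk).
rewrite !(bigD1 k (P := predT)) //= !P /subst1 !(inj_eq perm_inj) !xpair_eqE !eqxx /=.
by ring.
Qed.

(** Infinitesimal form of [Pf (A^T Om A) = det A * Pf Om]: only the replacements of an index by
    itself survive, and they add up to the trace. *)
Lemma pf_derivation Om B :
  \sum_(s : {perm I}) (-1) ^+ s *
    (\sum_k (\sum_c (B c (s (k, 0)) * Om c (s (k, 1)) +
                     B c (s (k, 1)) * Om (s (k, 0)) c)) *
      \prod_(l | l != k) Om (s (l, 0)) (s (l, 1))) =
  (\sum_d B d d) * pf Om.
Proof.
under eq_bigr do rewrite sum_prod_subst1 mulr_sumr.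
rewrite exchange_big /= mulr_suml; apply: eq_bigr => d _.
under eq_bigr do rewrite mulr_sumr.
rewrite exchange_big /= (bigD1 d) //= [X in _ + X]big1 ?addr0 => [|c cd].
  rewrite mulr_sumr; apply: eq_bigr => s _; rewrite mulrCA.
  congr (_ * (_ * _)); apply: eq_bigr => k _.
  by rewrite /subst1; do 2 case: eqP => [->|_].
transitivity (B c d * 0); last by rewrite mulr0.
rewrite -[in RHS](pf_subst1_neq Om cd) mulr_sumr.
by apply: eq_bigr => s _; rewrite mulrCA.
Qed.

Lemma is_derive_pf {V : normedModType R} (Om : V -> I -> I -> R) B (x v : V) :
  (forall a b, is_derive x v (fun y => Om y a b)
     (\sum_c (B c a * Om x c b + B c b * Om x a c))) ->
  is_derive x v (fun y => pf (Om y)) ((\sum_d B d d) * pf (Om x)).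
Proof.
move=> Omd; rewrite -pf_derivation /pf; apply: is_derive_big => s.
apply: is_deriveZ; apply: is_derive_prod => k; exact: Omd.
Qed.

Lemma pf_scale (c : R) Om : pf (fun a b => c * Om a b) = c ^+ n * pf Om.
Proof.
rewrite /pf mulr_sumr; apply: eq_bigr => s _.
by rewrite big_split /= prodr_const card_ord mulrCA.
Qed.

(** The Gram matrix of the sum of the forms [dx_k /\ dy_k]. *)
Definition std_form (a b : I) : R :=
  if a.1 == b.1 then (b.2 == 1)%:R * (a.2 == 0)%:R - (b.2 == 0)%:R * (a.2 == 1)%:R
  else 0.

Definition flip (a : I) : I := (a.1, if a.2 == 0 then 1 else 0).

Lemma std_form_neq0 a b : std_form a b != 0 -> b = flip a.
Proof.
case: a b => [k a] [l b]; rewrite /std_form /flip /=.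
case: (k =P l) => [->|_]; last by rewrite eqxx.
by move: a b; apply: ord2_case; apply: ord2_case => //=;
  rewrite ?(mulr0, mul0r, subr0) ?eqxx.
Qed.

Definition pf_term s : R :=
  (-1) ^+ s * \prod_(k < n) std_form (s (k, 0)) (s (k, 1)).

Lemma pf_term1 : pf_term 1 = 1.
Proof.
rewrite /pf_term odd_perm1 mul1r big1 // => k _; rewrite !perm1 /std_form /= eqxx.
by rewrite mul1r mul0r subr0.
Qed.

Lemma tperm_pair (k l x : 'I_n) (b : 'I_2) :
  tperm (k, b) (l, b) (x, b) = (tperm k l x, b).
Proof.
case: (tpermP k l x) => [->|->|/eqP xk /eqP xl]; rewrite ?tpermL ?tpermR //.
by rewrite tpermD // xpair_eqE eqxx andbT eq_sym.
Qed.

Lemma tperm_pair_neq (k l x : 'I_n) (b c : 'I_2) : b != c ->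
  tperm (k, b) (l, b) (x, c) = (x, c).
Proof. by move=> bc; rewrite tpermD // xpair_eqE (negPf bc) andbF. Qed.

Definition swap_pairs (k l : 'I_n) : {perm I} :=
  (tperm (k, 0%R : 'I_2) (l, 0%R : 'I_2) *
   tperm (k, 1%R : 'I_2) (l, 1%R : 'I_2))%g.

Lemma swap_pairsE k l a : swap_pairs k l a = (tperm k l a.1, a.2).
Proof.
case: a => x b; rewrite permM; move: b; apply: ord2_case.
  by rewrite tperm_pair tperm_pair_neq.
by rewrite tperm_pair_neq // tperm_pair.
Qed.

(** Exchanging two whole pairs is a product of two transpositions, hence even, and preserves
    [std_form]. *)
Lemma pf_term_swap s k l : k != l ->
  pf_term (s * swap_pairs k l)%g = pf_term s.
Proof.
move=> kl; rewrite /pf_term !odd_permM !odd_tperm !xpair_eqE (negPf kl) /= addbF.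
congr (_ * _); apply: eq_bigr => x _.
by rewrite !(permM s) !swap_pairsE /std_form /= (inj_eq perm_inj).
Qed.

Lemma flipK : involutive flip.
Proof. by case=> k; apply: ord2_case. Qed.

(** These permutations carry each pair [x_k, y_k] to such a pair; all others contribute 0 to the
    Pfaffian. *)
Definition pair_perm s := forall k, s (k, 1) = flip (s (k, 0)).

Lemma pair_perm_flip s a : pair_perm s -> s (flip a) = flip (s a).
Proof.
move=> ps; case: a => k; apply: ord2_case; first exact: ps.
by rewrite ps flipK.
Qed.

Lemma fst_eq_flip (a b : I) : a.1 = b.1 -> b = a \/ b = flip a.
Proof.
case: a b => k a [l b] /= ->; move: a b.
by apply: ord2_case; apply: ord2_case; (by left) || (by right).
Qed.

Lemma pair_perm_inj s a b : pair_perm s -> (s a).1 = (s b).1 -> a.1 = b.1.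
Proof.
move=> ps /fst_eq_flip[/perm_inj->//|].
by rewrite -pair_perm_flip // => /perm_inj ->.
Qed.

(** Termination measure for sorting: a misplaced pair weighs 3, a pair in place with its entries
    interchanged weighs 1. A swap thus pays off even when the pair arrives interchanged. *)
Definition pair_defect s : nat :=
  (\sum_(k < n) (((s (k, 0%R)).1 != k).*2 + (s (k, 0%R) != (k, 0%R))))%N.

(** The permutation is sorted to the identity by two moves that preserve the term: swapping two
    pairs, and interchanging the entries of one pair, where the sign of [s] and that of one factor
    change together. *)
Lemma pf_term_pair s : pair_perm s -> pf_term s = 1.
Proof.
have [N] := ubnP (pair_defect s); elim: N s => // N IH s sN ps.
have [/forallP s1|] := boolP [forall k, s (k, 0) == (k, 0)].
  suff -> : s = 1%g by exact: pf_term1.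
  apply/permP => -[k]; apply: ord2_case; rewrite perm1 ?ps (eqP (s1 k)) //.
rewrite negb_forall => /existsP[k sk].
have [lk|lk] := eqVneq (s (k, 0)).1 k; last first.
  rewrite -(pf_term_swap s (k := k) (l := (s (k, 0)).1)); last by rewrite eq_sym.
  set s' := (s * _)%g.
  have sE a : s' a = (tperm k (s (k, 0)).1 (s a).1, (s a).2).
    by rewrite (permM s) swap_pairsE.
  apply: IH; last by move=> x; rewrite !sE ps.
  rewrite -ltnS; apply: leq_trans sN; rewrite ltnS /pair_defect.
  rewrite (bigD1 k) // [X in (_ < X)%N](bigD1 k) //= -addSn leq_add //.
    by rewrite !sE /= tpermR eqxx lk sk; case: (_ != _).
  apply: leq_sum => x xk; rewrite !sE /=.
  (* The position that held pair [k] had the maximal weight already, so whatever it receives cannot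
     increase the measure. *)
  have [xs|xs] := eqVneq (s (x, 0)).1 k.
    have kx : (s (x, 0)).1 != x by rewrite xs eq_sym.
    have -> : s (x, 0) != (x, 0) by apply: contra kx => /eqP->.
    by rewrite kx; do 2 case: (_ != _).
  have xl : (s (k, 0)).1 != (s (x, 0)).1.
    by apply: contra xk => /eqP /(pair_perm_inj ps) /= ->.
  by rewrite tpermD // 1?eq_sym // -surjective_pairing.
(* The remaining defect: the pair is in its place with its entries interchanged. *)
have s0 : s (k, 0) = (k, 1).
  move: sk; rewrite [s (k, 0)]surjective_pairing lk xpair_eqE eqxx /=.
  by move: (s (k, 0)).2; apply: ord2_case.
have s1 : s (k, 1) = (k, 0) by rewrite ps s0.
set t := tperm (k, 0 : 'I_2) (k, 1).
have tE x b : x != k -> t (s (x, b)) = s (x, b).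
  move=> xk; rewrite /t tpermD //; apply: contra xk => /eqP E.
    by apply/eqP/(@pair_perm_inj s (x, b) (k, 1) ps); rewrite -E s1.
  by apply/eqP/(@pair_perm_inj s (x, b) (k, 0) ps); rewrite -E s0.
have -> : pf_term s = pf_term (s * t)%g.
  rewrite /pf_term odd_permM odd_tperm xpair_eqE andbF addbT signrN.
  rewrite (bigD1 k) // [in RHS](bigD1 k) //= !permM s0 s1 /t tpermR tpermL.
  rewrite mulNr -mulrN -mulNr; congr (_ * (_ * _)).
    by rewrite /std_form /= eqxx !(mul0r, mulr0, subr0, sub0r, mul1r).
  by apply: eq_bigr => x xk; rewrite !permM !tE.
apply: IH; last first.
  move=> x; rewrite !(permM s); have [->|xk] := eqVneq x k.
    by rewrite s0 s1 /t tpermR tpermL.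
  by rewrite !tE // ps.
rewrite -ltnS; apply: leq_trans sN; rewrite ltnS /pair_defect.
rewrite (bigD1 k) // [X in (_ < X)%N](bigD1 k) //= -addSn leq_add //.
  by rewrite permM s0 /t tpermR /= !xpair_eqE !eqxx.
by apply: leq_sum => x xk; rewrite permM tE.
Qed.

Lemma pf_term_ge0 s : 0 <= pf_term s.
Proof.
have [ps|] := pselect (pair_perm s); first by rewrite pf_term_pair // ler01.
move=> /existsNP[k sk]; rewrite /pf_term (bigD1 k) //=.
have [->|/std_form_neq0//] := eqVneq (std_form (s (k, 0)) (s (k, 1))) 0.
by rewrite mul0r mulr0.
Qed.

(** The identity contributes 1 and no summand is negative, so the nonzero summands need not be
    counted. *)
Lemma pf_std_gt0 : 0 < pf std_form.
Proof.
rewrite /pf (bigD1 1%g) //= -/(pf_term 1) pf_term1 ltr_pwDl //.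
by apply: sumr_ge0 => s _; exact: pf_term_ge0.
Qed.

End Pfaffian.

(** * The Liouville density *)

Section Density.
Context {R : realType} {n : nat}.
Local Notation I := ('I_n * 'I_2)%type.
Implicit Types (w v x y : Cvec R n).

Definition basis_vec (a : I) : Cvec R n := delta_mx a.1 a.2.

Lemma linear_expand (L : Cvec R n -> R) x :
  (forall x y, L (x + y) = L x + L y) -> (forall a x, L (a *: x) = a * L x) ->
  L x = \sum_(a : I) x a.1 a.2 * L (basis_vec a).
Proof.
move=> LD LZ; have L0 : L 0 = 0 by rewrite -(scale0r (0 : Cvec R n)) LZ mul0r.
rewrite {1}(matrix_sum_delta x) pair_bigA (big_morph L LD L0).
by apply: eq_bigr => a _; rewrite LZ.
Qed.

Lemma fs_formDl w x x' y : fs_form w (x + x') y = fs_form w x y + fs_form w x' y.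
Proof. by rewrite /fs_form !creDl !cimDl; ring. Qed.
Lemma fs_formZl w a x y : fs_form w (a *: x) y = a * fs_form w x y.
Proof. by rewrite /fs_form !creZl !cimZl; ring. Qed.
Lemma fs_formDr w x y y' : fs_form w x (y + y') = fs_form w x y + fs_form w x y'.
Proof. by rewrite /fs_form !creDr !cimDr; ring. Qed.
Lemma fs_formZr w a x y : fs_form w x (a *: y) = a * fs_form w x y.
Proof. by rewrite /fs_form !creZr !cimZr; ring. Qed.

(* The derivative of [fs_form] along v is its pullback by the infinitesimal
   automorphism [fs_conn w v]. *)
Definition fs_conn w v x : Cvec R n :=
  (- (fs w)^-1) *: (cre w v *: x + (cre w x *: v + cim w x *: cJ v)).

Lemma fs_connE w v x k b : fs_conn w v x k b =
  - (fs w)^-1 * (cre w v * x k b + (cre w x * v k b + cim w x * cJ v k b)).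
Proof. by rewrite /fs_conn; move: (cJ v) => u; rewrite !mxE. Qed.

Lemma is_derive_cim v w y : is_derive w v (fun w => cim w y) (cim v y).
Proof.
have E u : cim u y = cre (- cJ y) u by rewrite -scaleN1r creZl cre_Jl cimC; ring.
under eq_fun do rewrite E; rewrite E; exact: is_derive_cre.
Qed.

Lemma is_derive_fs_form w v x y :
  is_derive w v (fun w => fs_form w x y)
    (fs_form w (fs_conn w v x) y + fs_form w x (fs_conn w v y)).
Proof.
have q0 := fs_neq0 w; have dq := is_derive_fs v w.
have p0 : (pi : R) != 0 by rewrite lt0r_neq0 // pi_gt0.
have dx : is_derive w v (cre x) (cre x v) by exact: is_derive_cre.
have dy : is_derive w v (fun w => cre w y) (cre y v).
  by under eq_fun do rewrite creC; exact: is_derive_cre.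
have dyi := is_derive_cim v w y.
have dxi : is_derive w v (fun w => cim x w) (- cim v x).
  by under eq_fun do rewrite cimC; apply: is_deriveN; exact: is_derive_cim.
have dV := is_derive_inv q0 dq.
have pq0 : (pi \*: (fs : Cvec R n -> R)) w != 0 by rewrite mulf_neq0.
have dP := is_derive_inv pq0 (is_deriveZ pi dq).
have dN := is_deriveM (is_deriveD (is_deriveM dx dyi) (is_deriveM dxi dy)) dV.
have D := is_deriveM dP (is_deriveB (is_derive_cst (cim x y) w v) dN).
apply: (is_derive_eq D); rewrite !fctE /GRing.scale /= /fs_form /fs_conn.
rewrite !(creZl, creZr, cimZl, cimZr, creDl, creDr, cimDl, cimDr).
rewrite !(cre_Jl, cre_Jr, cim_Jl, cim_Jr).
rewrite [cre w x]creC [cim w x]cimC [cre v w]creC [cim v w]cimC [cre v y]creC.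
rewrite [cim x v]cimC.
move: (@pi R) p0 (fs w) q0 => P p0 q q0 {D dN dP dV pq0 dxi dyi dx dy dq}.
move: (cre w v) (cim w v) (cre x w) (cim x w) (cre w y) (cim w y) => a a' b b' c c'.
move: (cre x v) (cim v x) (cre y v) (cim v y) (cim x y) => d d' e e' f.
by rewrite -![P *: q]/(P * q); field; rewrite p0 q0.
Qed.

(** Over the reals the scalar part [Re <w, v> x] has trace [2 n Re <w, v>], and the complex rank-one
    part [<w, x> v] adds [2 Re <w, v>]. *)
Lemma trace_fs_conn w v :
  \sum_(a : I) fs_conn w v (basis_vec a) a.1 a.2 =
  - (n.+1%:R * (2 * cre w v)) / fs w.
Proof.
have -> : \sum_(a : I) fs_conn w v (basis_vec a) a.1 a.2 = - (fs w)^-1 *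
    (\sum_(a : I) cre w v + (\sum_(a : I) v a.1 a.2 * cre w (basis_vec a) +
    \sum_(a : I) cJ v a.1 a.2 * cim w (basis_vec a))).
  rewrite -!big_split mulr_sumr; apply: eq_bigr => a _ /=.
  by rewrite fs_connE {1}/basis_vec [delta_mx _ _ _ _]mxE !eqxx /=; ring.
rewrite -(@linear_expand (cre w)) -?(@linear_expand (cim w)) ?cim_Jr.
- rewrite sumr_const card_prod !card_ord -[cre w v *+ _]mulr_natl natrM -(natr1 n).
  by ring.
- exact: cimDr.
- by move=> *; rewrite cimZr.
- exact: creDr.
- by move=> *; rewrite creZr.
Qed.

Definition fs_coef w (a b : I) : R := fs_form w (basis_vec a) (basis_vec b).

Lemma is_derive_pf_fs w v : is_derive w v (fun w => pf (fs_coef w))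
  (- (n.+1%:R * (2 * cre w v)) / fs w * pf (fs_coef w)).
Proof.
rewrite -trace_fs_conn.
apply: (is_derive_pf (B := fun c a => fs_conn w v (basis_vec a) c.1 c.2)) => a b.
apply: (is_derive_eq (is_derive_fs_form w v (basis_vec a) (basis_vec b))).
rewrite (@linear_expand (fun x => fs_form w x (basis_vec b))); last 2 first.
- by move=> *; rewrite fs_formDl.
- by move=> *; rewrite fs_formZl.
rewrite (@linear_expand (fs_form w (basis_vec a)) (fs_conn _ _ _)); last 2 first.
- by move=> *; rewrite fs_formDr.
- by move=> *; rewrite fs_formZr.
by rewrite -big_split.
Qed.

Lemma fs0 : fs (0 : Cvec R n) = 1.
Proof.
by rewrite /fs -(scale0r (0 : Cvec R n)) creZl mul0r addr0.
Qed.

(** At the origin the Fubini-Study form is the standard form divided by pi. *)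
Lemma pf_fs0_neq0 : pf (fs_coef 0) != 0.
Proof.
have -> : fs_coef 0 = fun a b => pi^-1 * std_form a b.
  apply/funext => a; apply/funext => b; rewrite /fs_coef /fs_form fs0 mulr1.
  have c0 x : cre x 0 = 0 by rewrite -(scale0r (0 : Cvec R n)) creZr mul0r.
  have c0' x : cim x 0 = 0 by rewrite -(scale0r (0 : Cvec R n)) cimZr mul0r.
  rewrite c0 c0' !mul0r addr0 mul0r subr0; congr (_ * _).
  rewrite /cim (bigD1 a.1) //= big1 ?addr0 => [|k ka].
    rewrite !mxE !eqxx /= /std_form [b.2 == 0]eq_sym [b.2 == 1]eq_sym.
    rewrite [a.2 == 0]eq_sym [a.2 == 1]eq_sym.
    by case: (a.1 == b.1) => /=; ring.
  by rewrite !mxE (negPf ka) /=; ring.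
rewrite pf_scale mulf_neq0 // ?expf_neq0 ?invr_eq0 ?(lt0r_neq0 (pi_gt0 _)) //.
exact/lt0r_neq0/pf_std_gt0.
Qed.

(* pf * fs^(n+1) is constant along rays from the origin. *)
Lemma pf_fs_neq0 w : pf (fs_coef w) != 0.
Proof.
pose F (u : Cvec R n) := pf (fs_coef u) * fs u ^+ n.+1.
have Fd u v : is_derive u v F 0.
  have D := is_deriveM (is_derive_pf_fs u v) (is_deriveX n.+1 (is_derive_fs v u)).
  have -> : F = (fun u => pf (fs_coef u)) * (fs ^+ n.+1).
    by apply/funext => u'; rewrite /F mulrfctE exprfctE.
  apply: (is_derive_eq D); rewrite !exprfctE /GRing.scale /= exprS.
  have q0 := fs_neq0 u; move: (pf _) (fs u) q0 (cre u v) => a q q0 b.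
  by field.
have H (t : R) : is_derive t 1 (fun s : R => F (0 + s *: w)) 0.
  have := is_derive_line (@ex_derive _ _ _ _ _ _ _ (Fd (0 + t *: w) w)).
  by rewrite (@derive_val _ _ _ _ _ _ _ (Fd (0 + t *: w) w)).
have := is_derive_0_is_cst 1 0 H; rewrite scale1r scale0r !add0r /F fs0.
rewrite expr1n mulr1 => E; apply/eqP => pw.
by have /eqP := pf_fs0_neq0; rewrite -E pw mul0r.
Qed.

Lemma liouville_density B h (om : CP R n -> tvec R n -> tvec R n -> R) j w :
  0 < h -> is_delzant_poisson h B -> is_symplectic_form_of B om ->
  density (liouville om) j w =
  (n`!%:R)^-1 * (2 ^+ n)^-1 * pf (fs_coef w).
Proof.
move=> h0 dB omB; rewrite /density /liouville /wedge_power mulrA; congr (_ * _).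
apply: eq_bigr => s _; congr (_ * _); apply: eq_bigr => k _.
exact: (symplectic_formE j w _ _ h0 dB omB).
Qed.

End Density.

(** * The modular vector field *)

(** The Hessian applied to [v], as the derivative of the gradient; locking keeps [mxE] and
    conversion from unfolding it. *)
HB.lock Definition hess {R : realType} {n : nat} (f : smoothfn R n)
    (j : 'I_n.+1) (w v : Cvec R n) : Cvec R n :=
  \matrix_(k, b) 'D_v (fun w => grad f j w k b) w.

Section Modular.
Context {R : realType} {n : nat}.
Implicit Types (w v u c : Cvec R n) (f : smoothfn R n).
Implicit Type B : smoothfn R n -> smoothfn R n -> smoothfn R n.

Lemma grad_fun f j k b :
  (fun w => grad f j w k b) = 'D_(delta_mx k b) (f \o affine j).
Proof. by apply/funext => w; rewrite mxE. Qed.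

Lemma hessE f j w v k b :
  hess f j w v k b = 'D_v ('D_(delta_mx k b) (f \o affine j)) w.
Proof. by rewrite -grad_fun unlock mxE. Qed.

Lemma diff_grad f j k b w : differentiable ('D_(delta_mx k b) (f \o affine j)) w.
Proof.
exact: smooth_on_diff (smooth_on_derive _ (smoothfnP f j)) _.
Qed.

Lemma is_derive_grad f j w v k b :
  is_derive w v (fun w => grad f j w k b) (hess f j w v k b).
Proof.
by rewrite hessE grad_fun; apply/derivableP/diff_derivable/diff_grad.
Qed.

Lemma hess_delta f j w k b l b' :
  hess f j w (delta_mx l b') k b = hess f j w (delta_mx k b) l b'.
Proof.
apply: etrans (hessE f j w (delta_mx l b') k b) _.
apply: etrans (derive_sym w (delta_mx k b) (delta_mx l b') (smoothfnP f j 2)) _.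
exact/esym/hessE.
Qed.

Lemma hess_sum f j w v k b : hess f j w v k b =
  \sum_(a : 'I_n * 'I_2) v a.1 a.2 * hess f j w (basis_vec a) k b.
Proof.
apply: etrans (hessE f j w v k b) _.
apply: etrans (derive_delta v (diff_grad f j k b w)) _.
rewrite pair_bigA; apply: eq_bigr => a _; congr (_ * _); exact/esym/hessE.
Qed.

Lemma cre_pair (u v : Cvec R n) :
  cre u v = \sum_(a : 'I_n * 'I_2) u a.1 a.2 * v a.1 a.2.
Proof. by rewrite creE pair_bigA. Qed.

Lemma cre_hess_sym f j w u v : cre u (hess f j w v) = cre v (hess f j w u).
Proof.
rewrite !cre_pair; under eq_bigr do rewrite hess_sum mulr_sumr.
rewrite exchange_big; apply: eq_bigr => a _; rewrite [in RHS]hess_sum mulr_sumr.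
by apply: eq_bigr => c _; rewrite mulrCA /basis_vec hess_delta.
Qed.

(** The right-hand side is the shape in which second derivatives occur in a divergence, one
    coordinate direction at a time. *)
Lemma cre_hess_sum f j w u v : cre u (hess f j w v) =
  \sum_k (v k 0 * cre u (hess f j w (delta_mx k 0)) +
          v k 1 * cre u (hess f j w (delta_mx k 1))).
Proof.
rewrite cre_hess_sym {1}/cre; apply: eq_bigr => k _.
by rewrite ![cre u _]cre_hess_sym !(creC (delta_mx _ _)) !cre_deltar.
Qed.

Lemma is_derive_cre_grad f j w v : is_derive w v (fun w => cre w (grad f j w))
  (cre v (grad f j w) + cre w (hess f j w v)).
Proof.
have d k b := is_deriveM (is_derive_coord k b w v) (is_derive_grad f j w v k b).
have D := is_derive_big (index_enum _) xpredT (fun k => is_deriveD (d k 0) (d k 1)).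
apply: (is_derive_eq D); rewrite -big_split; apply: eq_bigr => k _ /=.
by rewrite /GRing.scale /=; ring.
Qed.

Lemma is_derive_cim_grad f j w v : is_derive w v (fun w => cim w (grad f j w))
  (cim v (grad f j w) + cim w (hess f j w v)).
Proof.
have d k b b' :=
  is_deriveM (is_derive_coord k b w v) (is_derive_grad f j w v k b').
have D := is_derive_big (index_enum _) xpredT
  (fun k => is_deriveB (d k 0 1) (d k 1 0)).
apply: (is_derive_eq D); rewrite -big_split; apply: eq_bigr => k _ /=.
by rewrite /GRing.scale /=; ring.
Qed.

Lemma is_derive_normsq w v k :
  is_derive w v (fun w => normsq w k) (2 * (w k 0 * v k 0 + w k 1 * v k 1)).
Proof.
have d b := is_deriveM (is_derive_coord k b w v) (is_derive_coord k b w v).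
apply: (is_derive_eq (is_deriveD (d 0) (d 1))).
by rewrite /GRing.scale /=; ring.
Qed.

Lemma is_derive_toric_vec0 f j w v k :
  is_derive w v (fun w => toric_vec w (grad f j w) k 0)
  (- (2^-1 * (2 * (w k 0 * v k 0 + w k 1 * v k 1) * grad f j w k 1 +
              normsq w k * hess f j w v k 1 +
              (cre v (grad f j w) + cre w (hess f j w v)) * w k 1 +
              cre w (grad f j w) * v k 1 +
              (cim v (grad f j w) + cim w (hess f j w v)) * w k 0 +
              cim w (grad f j w) * v k 0))).
Proof.
have E w' : toric_vec w' (grad f j w') k 0 = _ := toric_vec0 _ _ _.
under eq_fun do rewrite E.
have D1 := is_deriveM (is_derive_normsq w v k) (is_derive_grad f j w v k 1).
have D2 := is_deriveM (is_derive_cre_grad f j w v) (is_derive_coord k 1 w v).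
have D3 := is_deriveM (is_derive_cim_grad f j w v) (is_derive_coord k 0 w v).
have D := is_deriveN (is_deriveZ (2^-1) (is_deriveD (is_deriveD D1 D2) D3)).
apply: (is_derive_eq D); rewrite /GRing.scale /=.
move: (grad f j w) (hess f j w v) => c h.
move: (cre w c) (cim w c) (cre v c) (cim v c) (cre w h) (cim w h) => a a' b b' d d'.
by ring.
Qed.

Lemma is_derive_toric_vec1 f j w v k :
  is_derive w v (fun w => toric_vec w (grad f j w) k 1)
  (2^-1 * (2 * (w k 0 * v k 0 + w k 1 * v k 1) * grad f j w k 0 +
           normsq w k * hess f j w v k 0 +
           (cre v (grad f j w) + cre w (hess f j w v)) * w k 0 +
           cre w (grad f j w) * v k 0 -
           (cim v (grad f j w) + cim w (hess f j w v)) * w k 1 -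
           cim w (grad f j w) * v k 1)).
Proof.
have E w' : toric_vec w' (grad f j w') k 1 = _ := toric_vec1 _ _ _.
under eq_fun do rewrite E.
have D1 := is_deriveM (is_derive_normsq w v k) (is_derive_grad f j w v k 0).
have D2 := is_deriveM (is_derive_cre_grad f j w v) (is_derive_coord k 0 w v).
have D3 := is_deriveM (is_derive_cim_grad f j w v) (is_derive_coord k 1 w v).
have D := is_deriveZ (2^-1) (is_deriveB (is_deriveD D1 D2) D3).
apply: (is_derive_eq D); rewrite /GRing.scale /=.
move: (grad f j w) (hess f j w v) => c h.
move: (cre w c) (cim w c) (cre v c) (cim v c) (cre w h) (cim w h) => a a' b b' d d'.
by ring.
Qed.

Lemma cim_deltal k c : cim (delta_mx k 0) c = c k 1 /\ cim (delta_mx k 1) c = - c k 0.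
Proof.
split; rewrite -cre_Jl creC.
  by rewrite (_ : cJ _ = delta_mx k 1) ?cre_deltar //;
    apply: cmxP => l; rewrite !mxE /= ?andbT ?andbF ?oppr0.
rewrite (_ : cJ _ = (-1) *: delta_mx k 0) ?creZr ?cre_deltar ?mulN1r //.
by apply: cmxP => l; rewrite !mxE /= ?andbT ?andbF ?mulN1r ?oppr0.
Qed.

(** The terms [|w_k|^2 c_k] lose their second derivatives for each [k] separately, those from
    [<w, c> w_k] only after summation, by symmetry of the Hessian between [w] and [i w]. Of the
    remaining terms, one is [- Im <w, c>] for each [k], and the others sum to it once more. *)
Lemma toric_divergence f j w :
  \sum_k ('D_(delta_mx k 0) (fun w => toric_vec w (grad f j w) k 0) w +
          'D_(delta_mx k 1) (fun w => toric_vec w (grad f j w) k 1) w) =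
  - (n.+1%:R * cim w (grad f j w)).
Proof.
set c := grad f j w; pose H k b := hess f j w (delta_mx k b).
have T k : 'D_(delta_mx k 0) (fun w => toric_vec w (grad f j w) k 0) w +
          'D_(delta_mx k 1) (fun w => toric_vec w (grad f j w) k 1) w =
    - (w k 0 * c k 1 - w k 1 * c k 0) - cim w c +
    2^-1 * ((cJ w k 0 * cre w (H k 0) + cJ w k 1 * cre w (H k 1)) -
            (w k 0 * cre (cJ w) (H k 0) + w k 1 * cre (cJ w) (H k 1))).
  rewrite (@derive_val _ _ _ _ _ _ _ (is_derive_toric_vec0 _ _ _ _ _)).
  rewrite (@derive_val _ _ _ _ _ _ _ (is_derive_toric_vec1 _ _ _ _ _)).
  rewrite -/(H k 0) -/(H k 1) -/c.
  have -> : H k 1 k 0 = H k 0 k 1 by exact: hess_delta.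
  rewrite ![cre (delta_mx _ _) _]creC !cre_deltar (cim_deltal k c).1.
  rewrite (cim_deltal k c).2 !cre_Jl cJ0 cJ1 ![delta_mx _ _ _ _]mxE !eqxx /=.
  move: (H k 0) (H k 1) => h0 h1; clearbody c.
  move: (cre w c) (cim w c) (cre w h0) (cim w h0) (cre w h1) (cim w h1).
  by move=> a a' b b' d d'; field.
under eq_bigr do rewrite T.
rewrite !big_split /= -mulr_sumr sumrB !sumrN /= -!cre_hess_sum.
rewrite [cre w _]cre_hess_sym subrr mulr0 addr0 -/(cim w c).
rewrite sumr_const card_ord -[cim w c *+ n]mulr_natl -(natr1 n).
by ring.
Qed.

Lemma modularE B piD h om theta f j w : 0 < h ->
  is_toric_poisson B -> is_delzant_poisson h piD ->
  is_symplectic_form_of piD om -> is_modular B (liouville om) theta ->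
  theta f (affine j w) = n.+1%:R / fs w *
    \sum_k (normsq w k - 1) *
      (w k 0 * grad f j w k 1 - w k 1 * grad f j w k 0).
Proof.
move=> h0 tB dD omD [_ /(_ f j w)].
pose K : R := (n`!%:R)^-1 * (2 ^+ n)^-1.
have rhoE w' : density (liouville om) j w' = K * pf (fs_coef w').
  exact: liouville_density h0 dD omD.
have K0 : K != 0.
  by rewrite mulf_neq0 // invr_eq0 ?expf_neq0 // pnatr_eq0 -lt0n fact_gt0.
have rho0 : K * pf (fs_coef w) != 0 by rewrite mulf_neq0 // pf_fs_neq0.
pose rho w' := K * pf (fs_coef w').
have rhod v : is_derive w v rho (- (n.+1%:R * (2 * cre w v)) / fs w * rho w).
  apply: (is_derive_eq (is_deriveZ K (is_derive_pf_fs w v))).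
  by rewrite /rho /GRing.scale /=; ring.
set c := grad f j w; pose X w' := toric_vec w' (grad f j w').
have Xd k b v : derivable (fun w => X w k b) w v.
  by move: b; apply: ord2_case; apply: ex_derive;
    [exact: is_derive_toric_vec0|exact: is_derive_toric_vec1].
rewrite rhoE -/(rho w) /lie_density.
(* The product rule: [div (rho X) = rho div X + d_X rho], with [d_X rho = - (n+1) rho d_X q / q]. *)
have -> : \sum_(k < n) \sum_(b < 2) 'D_(delta_mx k b) (fun w' : Cvec R n =>
      density (liouville om) j w' *
      components j w' (value_at (B f) (affine j w')) k b) w =
    rho w * \sum_k ('D_(delta_mx k 0) (fun w => X w k 0) w +
          'D_(delta_mx k 1) (fun w => X w k 1) w) -
    n.+1%:R * 2 / fs w * rho w * cre w (X w).
  rewrite mulr_sumr [cre _ _]/cre mulr_sumr -sumrB; apply: eq_bigr => k _.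
  rewrite sum2.
  have T b : 'D_(delta_mx k b) (fun w' : Cvec R n =>
      density (liouville om) j w' *
      components j w' (value_at (B f) (affine j w')) k b) w =
      rho w * 'D_(delta_mx k b) (fun w => X w k b) w -
      n.+1%:R * 2 / fs w * rho w * (w k b * X w k b).
    rewrite (_ : (fun w' => _) = rho * (fun w => X w k b)); last first.
      by apply/funext => w'; rewrite rhoE (toric_hamE _ _ _ tB) componentsE.
    rewrite deriveM // derive_val /GRing.scale /= cre_deltar.
    by move: ('D_ _ _ _) => d; ring.
  rewrite !T; move: ('D_ _ _ _) ('D_ _ _ _) => d d'.
  by ring.
rewrite toric_divergence [cre w _]creC cre_toric_vec -/c cim_id.
(* With [|w|^2 = q - 1] the multiples of [Im <w, c>] combine to [- (n+1) / q], which is the -1 in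
   [|w_k|^2 - 1]. *)
have -> : cre w w = fs w - 1 by rewrite /fs; ring.
have -> : \sum_k normsq w k / 2 * (c k 0 * w k 1 - c k 1 * w k 0) =
    - (2^-1 * \sum_k normsq w k * (w k 0 * c k 1 - w k 1 * c k 0)).
  by rewrite mulr_sumr -sumrN; apply: eq_bigr => k _; field.
have -> : \sum_k (normsq w k - 1) * (w k 0 * c k 1 - w k 1 * c k 0) =
    \sum_k normsq w k * (w k 0 * c k 1 - w k 1 * c k 0) - cim w c.
  by rewrite -sumrB; apply: eq_bigr => k _; ring.
move=> E; apply: (mulIf rho0); rewrite -[RHS]/(_ * rho w) -E.
have q0 := fs_neq0 w; move: (fs w) q0 (cim w c) (cre w c) (rho w) => q q0 a b r.
by move: (\sum_k _) => S; field.
Qed.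

End Modular.

(** * Faces of the simplex *)

Section Pairing.
Context {R : realType} {n : nat}.
Implicit Types (nu : 'rV[R]_n) (x : 'cV[R]_n).

Lemma pairingE nu x : pairing nu x = \sum_i nu 0 i * x i 0.
Proof. by rewrite /pairing mxE. Qed.

Lemma pairing_sumr nu m (x : 'I_m -> 'cV[R]_n) :
  pairing nu (\sum_i x i) = \sum_i pairing nu (x i).
Proof. by rewrite /pairing mulmx_sumr summxE. Qed.

Lemma pairingNr nu x : pairing nu (- x) = - pairing nu x.
Proof. by rewrite /pairing mulmxN mxE. Qed.

Lemma pairing_comb m (nu : 'I_m -> 'rV[R]_n) (c : 'I_m -> R) x :
  pairing (\sum_i c i *: nu i) x = \sum_i c i * pairing (nu i) x.
Proof.
rewrite /pairing mulmx_suml summxE; apply: eq_bigr => i _.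
by rewrite -scalemxAl mxE.
Qed.

End Pairing.

(** * Barycentric coordinates, faces, centroids and relative interiors *)

Section Simplex.
Context {R : realType} {n : nat} (u : 'I_n -> 'cV[R]_n) (hu : is_basis u).
Implicit Types (nu : 'rV[R]_n) (l m : 'I_n.+1) (S : {set 'I_n.+1}).

Definition bary l nu : R := pairing nu (normals u l) + n.+1%:R^-1.

Lemma normals_lift k : normals u (lift ord_max k) = u k.
Proof. by rewrite /normals liftK. Qed.

Lemma normals_max : normals u ord_max = - \sum_k u k.
Proof. by rewrite /normals unlift_none. Qed.

Lemma sum_bary nu : \sum_l bary l nu = 1.
Proof.
rewrite big_split /= sumr_const card_ord -[_ *+ n.+1]mulr_natl mulfV ?pnatr_eq0 //.
rewrite (bigD1_ord ord_max) //= normals_max pairingNr pairing_sumr.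
by under [X in _ + X + _]eq_bigr do rewrite normals_lift; rewrite addNr add0r.
Qed.

Lemma bary_inj nu nu' : (forall l, bary l nu = bary l nu') -> nu = nu'.
Proof.
move=> E; apply: (can_inj (mulmxK hu)); apply/rowP => k; rewrite !mxE.
have := E (lift ord_max k); rewrite /bary normals_lift => /addIr.
rewrite !pairingE => {}E.
by under eq_bigr do rewrite mxE; under [RHS]eq_bigr do rewrite mxE.
Qed.

Definition bary_point (c : 'I_n.+1 -> R) : 'rV[R]_n :=
  (\row_k (c (lift ord_max k) - n.+1%:R^-1)) *m
  invmx (\matrix_(i, k) u k i 0).

Lemma bary_pointE c l : \sum_l c l = 1 -> bary l (bary_point c) = c l.
Proof.
move=> c1; have E k : bary (lift ord_max k) (bary_point c) = c (lift ord_max k).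
  rewrite /bary normals_lift.
  have := mulmxKV hu (\row_k (c (lift ord_max k) - n.+1%:R^-1)).
  move=> /rowP/(_ k); rewrite -/(bary_point c) [RHS]mxE mxE => e.
  rewrite pairingE (_ : \sum_i _ = c (lift ord_max k) - n.+1%:R^-1) ?subrK //.
  by rewrite -e; apply: eq_bigr => i _; congr (_ * _); rewrite mxE.
have [k ->//|->] := unliftP ord_max l.
(* The last coordinate is forced, because both families sum to 1. *)
have := sum_bary (bary_point c); rewrite -c1 !(bigD1_ord ord_max) //=.
by under eq_bigr do rewrite E; move/addIr.
Qed.

Lemma bary_comb d (x : 'I_d -> 'rV[R]_n) (c : 'I_d -> R) l : \sum_i c i = 1 ->
  bary l (\sum_i c i *: x i) = \sum_i c i * bary l (x i).
Proof.
move=> c1; rewrite /bary pairing_comb.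
by under [RHS]eq_bigr do rewrite mulrDr; rewrite big_split /= -mulr_suml c1 mul1r.
Qed.

Definition vtx l : 'rV[R]_n := bary_point (fun m => (m == l)%:R).

Lemma bary_vtx l m : bary m (vtx l) = (m == l)%:R.
Proof.
by rewrite bary_pointE // (bigD1 l) //= eqxx big1 ?addr0 // => k /negPf ->.
Qed.

Lemma vtx_inj : injective vtx.
Proof.
move=> l m /(congr1 (bary l)); rewrite !bary_vtx eqxx.
by case: eqP => // _ /eqP; rewrite oner_eq0.
Qed.

Lemma vtx_comb nu : nu = \sum_l bary l nu *: vtx l.
Proof.
apply: bary_inj => m; rewrite bary_comb ?sum_bary // (bigD1 m) //=.
rewrite bary_vtx eqxx mulr1 big1 ?addr0 // => l lm.
by rewrite bary_vtx eq_sym (negPf lm) mulr0.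
Qed.

(** An affine function is the barycentric mean of its values at the vertices. *)
Lemma pairing_bary nu xi c : pairing nu xi - c =
  \sum_l bary l nu * (pairing (vtx l) xi - c).
Proof.
rewrite {1}(vtx_comb nu) pairing_comb.
under [RHS]eq_bigr do rewrite mulrBr.
by rewrite sumrB -mulr_suml sum_bary mul1r.
Qed.

Definition subface S : set 'rV[R]_n :=
  [set nu | (forall l, 0 <= bary l nu) /\ (forall l, l \notin S -> bary l nu = 0)].

Lemma subface_vtx S l : l \in S -> subface S (vtx l).
Proof.
move=> lS; split=> m; rewrite bary_vtx ?ler0n // => mS.
by case: eqP mS => // ->; rewrite lS.
Qed.

(** [pairing nu xi - c] is a sum of nonnegative terms, so it vanishes iff every vertex of positive
    weight lies on the hyperplane. *)
Lemma subface_supporting S nu xi c : subface S nu ->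
  (forall l, l \in S -> c <= pairing (vtx l) xi) ->
  (pairing nu xi == c) = [forall l, (bary l nu == 0) || (pairing (vtx l) xi == c)].
Proof.
move=> [nu0 nuS] cS; rewrite -subr_eq0 pairing_bary psumr_eq0 => [|l _]; last first.
  have [lS|lS] := boolP (l \in S); last by rewrite nuS // mul0r.
  by rewrite mulr_ge0 // subr_ge0 cS.
apply/allP/forallP => H l; have := H l.
  by rewrite mem_index_enum mulf_eq0 subr_eq0; apply.
by rewrite mulf_eq0 subr_eq0.
Qed.

Lemma subface_max S nu : subface S nu -> exists2 l, l \in S & bary l nu != 0.
Proof.
move=> [nu0 nuS]; apply: contrapT => /forall2NP N.
have := sum_bary nu; rewrite big1 => [/esym/eqP|l _]; first by rewrite oner_eq0.
have [lS|/nuS//] := boolP (l \in S).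
by have [//|/negP/negPn/eqP] := N l.
Qed.

Lemma face_subface (F : set 'rV[R]_n) : is_face (simplex u) F ->
  exists S, F = subface S.
Proof.
move=> [_ [xi [c [cP FE]]]]; exists [set l | pairing (vtx l) xi == c]%SET.
have cv l : c <= pairing (vtx l) xi.
  apply: cP => m; rewrite -/(bary m (vtx l)) bary_vtx; exact: ler0n.
have H nu : simplex u nu -> (pairing nu xi == c) =
    [forall l, (bary l nu == 0) || (pairing (vtx l) xi == c)].
  move=> nuP; apply: (@subface_supporting [set: 'I_n.+1]%SET) => //.
  by split=> // l; rewrite inE.
rewrite FE; apply/seteqP; split=> nu.
  move=> [nuP /eqP]; rewrite H // => /forallP nuS; split=> // l.
  by rewrite inE => /negPf lS; have := nuS l; rewrite lS orbF => /eqP.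
move=> [nu0 nuS]; split=> //=; apply/eqP; rewrite H //; apply/forallP => l.
have [//|lS] := boolP (pairing (vtx l) xi == c); rewrite ?orbT // orbF.
by rewrite nuS // inE.
Qed.

Lemma vertices_subface S : vertices (subface S) = vtx @` [set` S].
Proof.
apply/seteqP; split=> [v [_ [xi [c [cS vE]]]]|_ [l /= lS <-]].
  have [vS /= vc] : (subface S `&` [set nu | pairing nu xi = c]) v by rewrite -vE.
  have cv l : l \in S -> c <= pairing (vtx l) xi by move=> /subface_vtx/cS.
  (* A vertex of nonzero weight in [v] lies on every hyperplane that supports the face at [v]; as
     this one meets it only in [v], that vertex is [v]. *)
  have [l lS lv] := subface_max vS; exists l => //.
  move/eqP: vc; rewrite (subface_supporting vS cv) => /forallP/(_ l).
  rewrite (negPf lv) /= => /eqP lc.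
  suff : [set v] (vtx l) by [].
  by rewrite vE; split=> //; exact: subface_vtx.
split; first by exists (vtx l).
have sumE nu : \sum_(m | m != l) bary m nu = 1 - bary l nu.
  by rewrite -[in RHS](sum_bary nu) [in RHS](bigD1 l) //= [RHS]addrC addKr.
(* This hyperplane is [bary l nu = 1]: the coordinate is at most 1 on the face, with equality only
   at [vtx l]. *)
exists (- normals u l), (n.+1%:R^-1 - 1); split=> [nu [nu0 _]|].
  rewrite pairingNr -subr_ge0 (_ : _ - _ = 1 - bary l nu); last by rewrite /bary; ring.
  by rewrite -sumE sumr_ge0.
apply/seteqP; split=> [_ ->|nu [[nu0 nuS] /=]].
  split; first exact: subface_vtx.
  rewrite /= pairingNr -[pairing _ _](addrK n.+1%:R^-1) -/(bary l _) bary_vtx eqxx.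
  by rewrite opprB.
rewrite pairingNr => E; have l1 : bary l nu = 1 by rewrite /bary -[pairing _ _]opprK E; ring.
have /eqP := sumE nu; rewrite l1 subrr psumr_eq0 // => /allP H.
apply: bary_inj => m; rewrite bary_vtx; have [->//|ml] := eqVneq m l.
by have /implyP/(_ ml)/eqP := H m (mem_index_enum m).
Qed.

Lemma bary_centroid S l : S != finset.set0 ->
  bary l (centroid (subface S)) = (l \in S)%:R / #|S|%:R.
Proof.
move=> S0; have S0' : (#|S|%:R : R) != 0 by rewrite pnatr_eq0 cards_eq0.
have fin : finite_set (vtx @` [set` S]) by exact/finite_image/finite_finset.
have pe : perm_eq (fset_set (vtx @` [set` S])) [seq vtx l | l in S].
  apply: uniq_perm; first exact: fset_uniq.
    by rewrite map_inj_uniq ?enum_uniq //; exact: vtx_inj.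
  move=> v; rewrite in_fset_set //; apply/idP/idP.
    by rewrite inE => -[m /= mS <-]; apply/fintype.imageP; exists m.
  by move=> /fintype.imageP[m mS ->]; rewrite inE; exists m.
have cE : #|` fset_set (vtx @` [set` S])|%fset = #|S|.
  by have := perm_size pe; rewrite size_image.
rewrite /centroid vertices_subface cE fsbig_finite //= (perm_big _ pe) /=.
rewrite big_image /= scaler_sumr.
have -> : \sum_(m in S) #|S|%:R^-1 *: vtx m =
    \sum_m ((m \in S)%:R / #|S|%:R) *: vtx m.
  rewrite big_mkcond; apply: eq_bigr => m _.
  by case: ifP => _; rewrite ?mul1r // mul0r scale0r.
rewrite bary_comb; last first.
  rewrite -mulr_suml -natr_sum; apply: etrans (mulfV S0'); congr (_%:R / _).
  by rewrite -big_mkcond sum1_card.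
rewrite (bigD1 l) //= bary_vtx eqxx mulr1 big1 ?addr0 // => m ml.
by rewrite bary_vtx eq_sym (negPf ml) mulr0.
Qed.

(** If the coordinate were 0, prolonging the segment from [vtx l] slightly beyond [nu] would stay in
    the affine hull but make it negative. *)
Lemma relint_subface_gt0 S nu l : relint (subface S) nu -> l \in S ->
  0 < bary l nu.
Proof.
move=> [nuS [e e0 H]] lS; rewrite lt_neqAle nuS.1 andbT; apply/eqP => l0.
(* The displacement [t (nu - vtx l)] is then shorter than [e]; the added 1 keeps the denominator
   positive. *)
pose t := e / (`|nu - vtx l| + 1).
have N1 : 0 < `|nu - vtx l| + 1 by rewrite ltr_wpDl.
have t0 : 0 < t by exact: divr_gt0.
pose c (i : 'I_2) := if i == 0 then 1 + t else - t.
pose x (i : 'I_2) := if i == 0 then nu else vtx l.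
have c1 : \sum_i c i = 1 by rewrite sum2 /c /=; ring.
have xS i : subface S (x i) by rewrite /x; case: ifP => // _; exact: subface_vtx.
have /H : affine_hull (subface S) (\sum_i c i *: x i) by exists 2%N, x, c.
have -> : \sum_i c i *: x i - nu = t *: (nu - vtx l).
  rewrite !big_ord_recl big_ord0 /c /x /= addr0 scalerDl scale1r scalerBr scaleNr.
  by rewrite addrAC [nu + _]addrC addrK.
case.
  rewrite normrZ gtr0_norm // /t mulrAC ltr_pdivrMr // ltr_pM2l // ltrDl.
  exact: ltr01.
move=> /(_ l); rewrite bary_comb // sum2 /c /x /= -l0 bary_vtx eqxx mulr0 add0r.
by rewrite mulr1 oppr_ge0 leNgt t0.
Qed.

Lemma bary_continuous l : continuous (bary l).
Proof.
move=> nu; rewrite /bary; under eq_fun do rewrite pairingE.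
have oT : open [set: 'rV[R]_n] by exact: openT.
suff : Ck_on setT 0 (fun nu : 'rV[R]_n =>
    \sum_i nu 0 i * normals u l i 0 + n.+1%:R^-1) by exact.
apply: Ck_onD => //; last exact: Ck_on_cst.
apply: Ck_on_sum => // i; apply: Ck_onM => //; [exact: Ck_on_coord|exact: Ck_on_cst].
Qed.

Lemma relint_subface S nu : subface S nu ->
  (forall l, l \in S -> 0 < bary l nu) -> relint (subface S) nu.
Proof.
move=> nuS nu0; split=> //.
have nearS l : \forall y \near nu, l \in S -> 0 < bary l y.
  have [lS|lS] := boolP (l \in S); last exact: (@filterE _ (nbhs nu)).
  have : \forall y \near nu, 0 < bary l y.
    exact: (@bary_continuous l nu _ (lt_nbhsr (nu0 l lS))).
  by apply: filterS.
have : nbhs nu [set y | forall l, l \in S -> 0 < bary l y].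
  exact: (filter_forall (nbhs_filter nu) nearS).
move=> /nbhs_ballP[e /= e0 He]; exists e => // y [m [x [c [xS c1 ->]]]] ye.
(* Points of the affine hull inherit the vanishing coordinates; positivity of the others is an open
   condition. *)
have y0 l : l \notin S -> bary l (\sum_i c i *: x i) = 0.
  move=> lS; rewrite bary_comb // big1 // => i _.
  by rewrite (xS i).2 // mulr0.
split=> // l; have [lS|/y0->//] := boolP (l \in S).
by apply/ltW/He => //; rewrite -ball_normE /= distrC.
Qed.

End Simplex.

(** * The momentum in a chart and the zeros of the modular field *)

Section Momentum.
Context {R : realType} {n : nat} (u : 'I_n -> 'cV[R]_n).

Lemma bary_momentum h (Phi : CP R n -> 'rV[R]_n) j w l : 0 < h ->
  is_delzant_momentum h u Phi ->
  bary u l (Phi (affine j w)) = normsq (homog j w) l / fs w.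
Proof.
move=> h0 PhiE; have t0 := zscale_neq0 w h0.
rewrite /bary affineE -(proj_scaler _ t0) PhiE; last exact: Zlevel_homog.
have -> : normsq (zscale h w *: homog j w) l =
    zscale h w ^+ 2 * normsq (homog j w) l by rewrite /normsq !mxE; ring.
by rewrite zscale_sqr // mulrA mulrA mulVf ?mul1r 1?mulrC // lt0r_neq0 ?planck_gt0.
Qed.

Lemma normsq_homog_id j (w : Cvec R n) : normsq (homog j w) j = 1.
Proof. by rewrite /normsq !homog_id /= expr1n expr0n addr0. Qed.

Lemma normsq_homog_lift j (w : Cvec R n) k :
  normsq (homog j w) (lift j k) = normsq w k.
Proof. by rewrite /normsq !homog_lift. Qed.

Lemma vanishes_modular B piD h om theta j (w : Cvec R n) : 0 < h ->
  is_toric_poisson B -> is_delzant_poisson h piD ->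
  is_symplectic_form_of piD om -> is_modular B (liouville om) theta ->
  vanishes_at theta (affine j w) <->
  forall k, normsq w k = 0 \/ normsq w k = 1.
Proof.
move=> h0 tB dD omD mT; have tE f := modularE f j w h0 tB dD omD mT.
split=> [v k|wk f].
  (* A gradient pointing along the rotation of [w_k] alone: its angular derivative is [|w_k|^2],
     which leaves [(|w_k|^2 - 1) |w_k|^2 = 0]. *)
  pose c : Cvec R n := \matrix_(l, b) (if l == k then cJ w l b else 0).
  have [f fE] := exists_grad j w c.
  have := v f; rewrite tE fE (bigD1 k) //= big1 => [|l lk]; last first.
    by rewrite !mxE (negPf lk); ring.
  rewrite /c !mxE eqxx /= addr0 (_ : w k 0 * w k 0 - _ = normsq w k); last first.
    by rewrite /normsq; ring.
  move/eqP; rewrite !mulf_eq0 invr_eq0 pnatr_eq0 (negPf (fs_neq0 w)) /= subr_eq0.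
  by move=> /orP[/eqP->|/eqP->]; [right|left].
rewrite tE big1 ?mulr0 // => k _.
case: (wk k) => [|->]; last by rewrite subrr mul0r.
move=> /eqP; rewrite {1}/normsq paddr_eq0 ?sqr_ge0 // !sqrf_eq0.
by move=> /andP[/eqP-> /eqP->]; rewrite !mul0r subrr mulr0.
Qed.

End Momentum.

Theorem theorem7p3 (R : realType) (n : nat) (hn : (0 < n)%N)
    (h : R) (hh : 0 < h)
    (u : 'I_n -> 'cV[R]_n) (hu : is_basis u)
    (PiSigma : smoothfn R n -> smoothfn R n -> smoothfn R n)
    (hPiSigma : is_toric_poisson PiSigma)
    (piDelta : smoothfn R n -> smoothfn R n -> smoothfn R n)
    (hpiDelta : is_delzant_poisson h piDelta)
    (omegaDelta : CP R n -> tvec R n -> tvec R n -> R)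
    (homegaDelta : is_symplectic_form_of piDelta omegaDelta)
    (PhiDelta : CP R n -> 'rV[R]_n)
    (hPhiDelta : is_delzant_momentum h u PhiDelta)
    (theta : smoothfn R n -> smoothfn R n)
    (htheta : is_modular PiSigma (liouville omegaDelta) theta)
    (F : set 'rV[R]_n) (hF : is_face (simplex u) F) :
  PhiDelta @^-1` (relint F) `&` [set p | vanishes_at theta p] =
  PhiDelta @^-1` [set centroid F].
Proof.
have [[nu0 Fnu0] _] := hF; have [S FE] := face_subface hu hF.
rewrite FE in Fnu0 *; have [l0 l0S _] := subface_max Fnu0.
have S0 : S != finset.set0 by apply/finset.set0Pn; exists l0.
have cS0 : (#|S|%:R : R) != 0 by rewrite pnatr_eq0 cards_eq0.
have cE l := bary_centroid hu l S0.
apply/seteqP; split=> p; have [j [w ->]] := CP_affine p => /=;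
  have bE l := bary_momentum j w l hh hPhiDelta;
  have q0 := fs_neq0 w;
  have vE := vanishes_modular j w hh hPiSigma hpiDelta homegaDelta htheta.
  move=> [rel /vE wk]; have [[_ out] _] := rel.
  have val l : normsq (homog j w) l = 0 \/ normsq (homog j w) l = 1.
    have [k ->|->] := unliftP j l; last by right; exact: normsq_homog_id.
    by rewrite normsq_homog_lift.
  have inS l : l \in S -> bary u l (PhiDelta (affine j w)) = (fs w)^-1.
    move=> lS; have := relint_subface_gt0 hu rel lS; rewrite bE.
    by case: (val l) => ->; rewrite ?mul0r ?ltxx // mul1r.
  have bS l : bary u l (PhiDelta (affine j w)) = (l \in S)%:R / fs w.
    by have [/inS->|/out->] := boolP (l \in S); rewrite ?mul1r ?mul0r.
  (* The coordinates are [1 / q] on [S] and 0 elsewhere, and they sum to 1. *)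
  have qE : fs w = #|S|%:R.
    have := sum_bary u (PhiDelta (affine j w)); under eq_bigr do rewrite bS.
    rewrite -mulr_suml -natr_sum -big_mkcond sum1_card => /(canRL (mulfVK q0)).
    by rewrite mul1r.
  by apply: (bary_inj hu) => l; rewrite bS cE qE.
move=> PhiE.
have cS l : normsq (homog j w) l / fs w = (l \in S)%:R / #|S|%:R.
  by rewrite -bE PhiE cE.
(* The chart index satisfies [|z_j| = 1], so its barycentric coordinate is nonzero, which forces [j]
   into [S] and fixes the scale. *)
have jS : (fs w)^-1 = #|S|%:R^-1.
  have := cS j; rewrite normsq_homog_id mul1r; case: (j \in S); rewrite ?mul1r //.
  by move/eqP; rewrite mul0r invr_eq0 (negPf q0).
have val l : normsq (homog j w) l = (l \in S)%:R.
  by have := cS l; rewrite -jS => /(mulIf (invr_neq0 q0)).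
split; last first.
  apply/vE => k; rewrite -(normsq_homog_lift j) val.
  by case: (_ \in S); [right|left].
rewrite PhiE; apply: relint_subface; last first.
  by move=> l lS; rewrite cE lS mul1r invr_gt0 lt0r cS0 ler0n.
split=> l; rewrite cE ?divr_ge0 ?ler0n //.
by move=> /negPf->; rewrite mul0r.
Qed.
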